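(* Let $d\geq 2$. For $E\subset(0,\infty)$ and a locally integrable $f$ on $\mathbb{R}^d$ let $A_tf(x)=\int_{\mathbb{S}^{d-1}}f(x-ty)\,d\sigma(y)$ and $M_Ef(x)=\sup_{t\in E}|A_tf(x)|$. Then the radial type set of $M_{[1,2]}$ satisfies $$\mathcal{T}^{rad}_{[1,2]}=\Delta(1)\setminus[Q_1(1),Q_2(1)].$$
   Context: $\sigma$ is the normalized surface measure on the unit sphere $\mathbb{S}^{d-1}$. The radial type set is $\mathcal{T}^{rad}_E=\{(1/p,1/q)\in[0,1]^2: M_E \text{ is bounded from } L^p_{rad}(\mathbb{R}^d)\text{ to } L^q(\mathbb{R}^d)\}$, where $L^p_{rad}$ denotes the radial functions in $L^p$ and boundedness means $\|M_Ef\|_{L^q(\mathbb{R}^d)}\le C\|f\|_{L^p(\mathbb{R}^d)}$ for all radial $f$ (with $1/\infty=0$). For $0\le\beta\le1$, $\Delta(\beta)$ is the closed triangle with vertices $O=(0,0)$, $Q_1(\beta)=(\frac{d-1}{d-1+\beta},\frac{d-1}{d-1+\beta})$, $Q_2(\beta)=(\frac{d(d-1)}{d^2-1+\beta},\frac{d-1}{d^2-1+\beta})$. $[P,Q]$ denotes the closed line segment with endpoints $P,Q$. *)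

(* Defs.v *)
From HB Require Import structures.
From mathcomp Require Import all_boot all_order all_algebra.
From mathcomp Require Import all_classical all_reals all_analysis.
Set Implicit Arguments. Unset Strict Implicit. Unset Printing Implicit Defensive.
Import Order.TTheory GRing.Theory Num.Theory.
Import numFieldNormedType.Exports.
Local Open Scope classical_set_scope.
Local Open Scope ring_scope.

Section Defs.
Variable R : realType.

(* Euclidean norm on R^d (the library norm on matrices is the sup norm). *)
Definition enorm (d : nat) (x : 'rV[R]_d) : R := Num.sqrt (\sum_(i < d) x 0 i ^+ 2).

Fixpoint iint (n : nat) (F : seq R -> \bar R) : \bar R :=
  match n with
  | 0 => F [::]
  | n'.+1 => (\int[@lebesgue_measure R]_x iint n' (fun s => F (x :: s)))%E
  end.

(* d-dimensional Lebesgue integral on R^d (Tonelli/Fubini: iterated integral). *)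
Definition integ (d : nat) (g : 'rV[R]_d -> \bar R) : \bar R :=
  iint d (fun s => g (\row_(i < d) nth 0 s i)).

Definition vol (d : nat) (A : set 'rV[R]_d) : \bar R :=
  integ (fun x => (\1_A x)%:E).

Definition borel_fun (d : nat) (f : 'rV[R]_d -> R) : Prop :=
  forall U : set R, open U -> (<<s @open 'rV[R]_d >>) (f @^-1` U).

Definition radial (d : nat) (f : 'rV[R]_d -> R) : Prop :=
  forall x y : 'rV[R]_d, enorm x = enorm y -> f x = f y.

(* Integral against the normalized surface measure sigma on S^{d-1}, with
   sigma(E) = |{r y : 0 < r <= 1, y in E}| / |B(0,1)| (Folland, Thm 2.49). *)
Definition sphere_int (d : nat) (h : 'rV[R]_d -> R) : \bar R :=
  ((fine (vol [set y : 'rV[R]_d | enorm y <= 1]))^-1)%:E *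
  integ (fun y : 'rV[R]_d =>
           if (0 < enorm y <= 1)%R then (h ((enorm y)^-1 *: y))%:E else 0%E).

Definition sph_avg (d : nat) (t : R) (f : 'rV[R]_d -> R) (x : 'rV[R]_d) : \bar R :=
  sphere_int (fun y => f (x - t *: y)).

Definition MaxE (d : nat) (E : set R) (f : 'rV[R]_d -> R) (x : 'rV[R]_d) : \bar R :=
  ereal_sup [set `|sph_avg t f x|%E | t in E].

(* L^p norm on R^d written with the reciprocal exponent a = 1/p in [0,1]
   (a = 0 means p = infinity: essential supremum). *)
Definition Lnorm_rec (d : nat) (a : R) (g : 'rV[R]_d -> \bar R) : \bar R :=
  if a == 0 then
    ereal_inf [set M : \bar R | (0 <= M)%E /\
                 vol [set x | (M < `|g x|)%E] = 0%E]
  else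
    poweR (integ (fun x => poweR `|g x|%E a^-1)) a.

Definition bounded_rad (d : nat) (E : set R) (a b : R) : Prop :=
  exists C : R, forall f : 'rV[R]_d -> R,
    borel_fun f -> radial f ->
    (Lnorm_rec a (fun x => (f x)%:E) < +oo)%E ->
    (Lnorm_rec b (MaxE E f) <= C%:E * Lnorm_rec a (fun x => (f x)%:E))%E.

Definition type_set_rad (d : nat) (E : set R) : set (R * R) :=
  [set ab | 0 <= ab.1 <= 1 /\ 0 <= ab.2 <= 1 /\ bounded_rad d E ab.1 ab.2].

Definition Q1 (d : nat) (beta : R) : R * R :=
  ((d.-1)%:R / (d.-1%:R + beta), (d.-1)%:R / (d.-1%:R + beta)).
Definition Q2 (d : nat) (beta : R) : R * R :=
  ((d * d.-1)%:R / ((d ^ 2).-1%:R + beta), (d.-1)%:R / ((d ^ 2).-1%:R + beta)).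

Definition Delta (d : nat) (beta : R) : set (R * R) :=
  [set ab | exists l1 l2 : R, 0 <= l1 /\ 0 <= l2 /\ l1 + l2 <= 1 /\
     ab = (l1 * (Q1 d beta).1 + l2 * (Q2 d beta).1,
           l1 * (Q1 d beta).2 + l2 * (Q2 d beta).2)].

Definition segment (P Q : R * R) : set (R * R) :=
  [set ab | exists s : R, 0 <= s <= 1 /\
     ab = ((1 - s) * P.1 + s * Q.1, (1 - s) * P.2 + s * Q.2)].

End Defs.

(* Main.v *)
(** For a radial f = psi(|.|^2) and |x| = r, rotation invariance gives
      A_t f(x) = c \int_{-1}^{1} psi(r^2 + t^2 - 2 r t v) (1 - v^2)^((d-3)/2) dv.

    Sufficiency, for p > d/(d-1).  Young's inequality yields the pointwise bound
      (A_t f)^p <= C \int psi^p(r^2 + t^2 - 2 r t v) (1 - v)^(d/2-1) dv,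
    whose right-hand side is at most C (1 + 1/r) ||f||_p^p.  Moreover the p-th power
    of the maximal function has a majorant in L^1((1 + r^(d-1)) dr) of norm at most
    C ||f||_p^p: for r >= 4 the integral only sees a shell of width O(1), and for
    r < 1/2 one applies the pointwise bound with an exponent p1 < p to the large
    part of f at each level (layer cake).  Writing
      M^q = M^p M^(q-p) <= M^p (C (1 + 1/r) ||f||_p^p)^(q/p - 1),
    the loss is harmless as long as q <= d p, since then
    (1 + 1/r)^(q/p - 1) r^(d-1) <= C (1 + r^(d-1)).

    Necessity.  Indicators of large balls force q >= p, indicators of annuli of
    width delta about the unit sphere, tested at |x| < delta, force q <= d p, and
    f(x) = |x|^(1-d) on eps < |x|^2 < 1, tested on 1 < |x| < 2 with t = |x|, forces
    p > d/(d-1): A_t f then grows like log (1/eps) while ||f||_p^p is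
    at most of that order. *)
Require Import Defs.
From HB Require Import structures.
From mathcomp Require Import all_boot all_order all_algebra.
From mathcomp Require Import all_classical all_reals all_analysis measurable_realfun.
From mathcomp Require Import ring lra.
Set Implicit Arguments. Unset Strict Implicit. Unset Printing Implicit Defensive.
Import Order.TTheory GRing.Theory Num.Theory.
Import numFieldNormedType.Exports.
Local Open Scope classical_set_scope.
Local Open Scope ring_scope.
Local Notation mu := lebesgue_measure.

(** Means may be infinite and suprema over t are nowhere shown measurable, so for finite p the upper
    bounds are proved for a real level l strictly below a single mean, with a majorant that depends
    on neither t nor l. Against the weight 1, which is what remains near the origin, the factor 1/r
    just fails to be integrable: the pointwise bound there is only of weak type. Using it with p1 <
    p makes it strong, as in Marcinkiewicz interpolation, and such a p1 above d/(d-1) exists because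
    the condition on p is open. In the logarithmic test with 1 < p <= d/(d-1), log (1/eps) would be
    bounded by a multiple of its own power 1/p < 1. For p = 1 that comparison is void, but then the
    norms of the test functions stay bounded. Integrals over R^d are iterated, so rotation
    invariance and polar coordinates are derived from translations, dilations and Fubini on the
    line. The constants come out of uniqueness arguments and are only known to be positive and
    finite. *)

Section Measurability.
Context d (T : measurableType d) (R : realType).
Implicit Types f g : T -> R.

(* Unlike [powR], [pw a x] vanishes for x <= 0, even when a = 0, so that integrands
   carry their domain of integration. *)
Definition pw (a x : R) : R := if 0 < x then x `^ a else 0.

Lemma measurable_sqrt f : measurable_fun setT f ->
  measurable_fun setT (fun x => Num.sqrt (f x)).
Proof.
move=> mf; apply: (measurableT_comp _ mf).
by apply: continuous_measurable_fun; exact: sqrt_continuous.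
Qed.

Lemma measurable_funpowR f a : measurable_fun setT f ->
  measurable_fun setT (fun x => f x `^ a).
Proof. by move=> mf; exact: (measurableT_comp (@measurable_powR R a) mf). Qed.

Lemma measurable_pw f a : measurable_fun setT f ->
  measurable_fun setT (fun x => pw a (f x)).
Proof.
move=> mf; apply: measurable_fun_ifT => //.
- by apply: measurable_fun_ltr => //.
- by apply: measurable_funpowR.
Qed.

Lemma measurable_boolR (b : T -> bool) : measurable_fun setT b ->
  measurable_fun setT (fun x => (b x)%:R : R).
Proof.
move=> mb; rewrite (_ : (fun x => (b x)%:R : R) = (fun x => if b x then 1 else 0)).
  by apply: measurable_fun_ifT.
by apply/funext => x; case: (b x).
Qed.

Lemma measurable_inner (f : T * R -> \bar R) : measurable_fun setT f ->
  (forall x, (0 <= f x)%E) ->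
  measurable_fun setT (fun x => \int[lebesgue_measure]_y f (x, y))%E.
Proof. by move=> mf f0; exact: measurable_fun_fubini_tonelli_F. Qed.

End Measurability.

(** The case of an inner integral leaves the nonnegativity of its integrand as a goal, which is why
    [pos] often follows. *)
Ltac meas :=
  match goal with
  | |- measurable_fun _ (fun _ => ?c) => exact: measurable_cst
  | |- measurable_fun _ (fun x => x) => exact: measurable_id
  | |- measurable_fun _ fst => exact: measurable_fst
  | |- measurable_fun _ snd => exact: measurable_snd
  | |- measurable_fun _ _ => assumption
  | |- measurable_fun _ (fun x => GRing.add (@?f x) (@?g x)) => first [apply: (@measurable_funD _ _ _ _ f g) | apply: (@emeasurable_funD _ _ _ _ f g)]; meas
  | |- measurable_fun _ (fun x => (- (@?f x))%R) => apply: (@measurable_funN _ _ _ _ f); meas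
  | |- measurable_fun _ (fun x => (@?f x * @?g x)%R) => apply: (@measurable_funM _ _ _ _ f g); meas
  | |- measurable_fun _ (fun x => (@?f x ^+ ?n)%R) => apply: (@measurable_funX _ _ _ _ f n); meas
  | |- measurable_fun _ (fun x => `|@?f x|%R) => apply: (measurableT_comp (@normr_measurable _ _) (_ : measurable_fun setT f)); meas
  | |- measurable_fun _ (fun x => Num.sqrt (@?f x)) => apply: (@measurable_sqrt _ _ _ f); meas
  | |- measurable_fun _ (fun x => (@?f x `^ ?a)%R) => apply: (@measurable_funpowR _ _ _ f a); meas
  | |- measurable_fun _ (fun x => pw ?a (@?f x)) => apply: (@measurable_pw _ _ _ f a); meas
  | |- measurable_fun _ (fun x => (@?f x)%:E) => apply: (measurableT_comp (@EFin_measurable _ _) (_ : measurable_fun setT f)); meas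
  | |- measurable_fun _ (fun x => (@?f x * @?g x)%E) => apply: (@emeasurable_funM _ _ _ _ f g); meas
  | |- measurable_fun _ (fun x => (poweR (@?f x) ?a)) => apply: (measurableT_comp (@measurable_poweR _ a) (_ : measurable_fun setT f)); meas
  | |- measurable_fun _ (fun x => GRing.natmul (GRing.one _) (nat_of_bool (@?b x))) => apply: (@measurable_boolR _ _ _ b); meas
  | |- measurable_fun _ (fun x => (@?f x) && (@?g x)) => apply: (@measurable_and _ _ _ f g); meas
  | |- measurable_fun _ (fun x => ~~ (@?f x)) => apply: (@measurable_neg _ _ _ f); meas
  | |- measurable_fun _ (fun x => Order.lt (@?f x) (@?g x)) => apply: (@measurable_fun_ltr _ _ _ _ f g); meas
  | |- measurable_fun _ (fun x => Order.le (EFin (@?f x)) (@?g x)) => apply: (@measurable_fun_lee _ _ _ _ (fun x => EFin (f x)) g); meas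
  | |- measurable_fun _ (fun x => Order.le (@?f x) (@?g x)) => first [apply: (@measurable_fun_ler _ _ _ _ f g) | apply: (@measurable_fun_lee _ _ _ _ f g)]; meas
  | |- measurable_fun _ (fun x => ((@?f x) == (@?g x))) => apply: (@measurable_fun_eqr _ _ _ _ f g); meas
  | |- measurable_fun _ (fun x => (@?f x, @?g x)) => apply: (@measurable_fun_pair _ _ _ _ _ _ f g); meas
  | |- measurable_fun _ (fun x => fst (@?f x)) => apply: (measurableT_comp (@measurable_fst _ _ _ _) (_ : measurable_fun setT f)); meas
  | |- measurable_fun _ (fun x => snd (@?f x)) => apply: (measurableT_comp (@measurable_snd _ _ _ _) (_ : measurable_fun setT f)); meas
  | H : measurable_fun setT ?psi |- measurable_fun _ (fun x => ?psi (@?f x)) => apply: (measurableT_comp H (_ : measurable_fun setT f)); meas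
  | |- measurable_fun _ (fun x => integral _ _ (@?f x)) =>
       let g := eval cbv beta in (fun p => f p.1 p.2) in apply: (@measurable_inner _ _ _ g); [meas | idtac]
  | |- measurable_fun _ _ => apply: measurable_fun_ifT; meas
  | _ => idtac
  end.

(** * Powers on the positive half-line, extended by zero *)

Section PwLemmas.
Variable R : realType.
Implicit Types a b x y : R.

Lemma pw_ge0 a x : 0 <= pw a x.
Proof. by rewrite /pw; case: ifPn => // _; exact: powR_ge0. Qed.

Lemma pw_gt0 a x : 0 < x -> 0 < pw a x.
Proof. by move=> x0; rewrite /pw x0; exact: powR_gt0. Qed.

Lemma pwE a x : 0 < x -> pw a x = x `^ a.
Proof. by rewrite /pw => ->. Qed.

Lemma pw_le0 a x : x <= 0 -> pw a x = 0.
Proof. by rewrite /pw ltNge => ->. Qed.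

Lemma pwM a x y : 0 < x -> pw a (x * y) = pw a x * pw a y.
Proof.
move=> x0; rewrite /pw pmulr_rgt0// x0; case: ifPn => y0; last by rewrite mulr0.
by rewrite powRM// ltW.
Qed.

Lemma pwD a b x : pw (a + b) x = pw a x * pw b x.
Proof.
rewrite /pw; case: ifPn => x0; last by rewrite mulr0.
by rewrite powRD ?(gt_eqF x0) ?implybT.
Qed.

Lemma pw0 x : 0 < x -> pw 0 x = 1.
Proof. by move=> x0; rewrite pwE// powRr0. Qed.

Lemma pw_powR a b x : b != 0 -> (pw a x) `^ b = pw (a * b) x.
Proof.
rewrite /pw; case: ifPn => x0 b0; first by rewrite powRrM.
by rewrite powR0.
Qed.

Lemma ler_pw a x y : 0 <= a -> x <= y -> pw a x <= pw a y.
Proof.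
move=> a0 xy; rewrite /pw; case: ifPn => x0; last first.
  by case: ifPn => // _; exact: powR_ge0.
by rewrite (lt_le_trans x0 xy) ge0_ler_powR// nnegrE ?ltW// (lt_le_trans x0 xy).
Qed.

Lemma ger_pw a x y : a <= 0 -> 0 < x -> x <= y -> pw a y <= pw a x.
Proof.
move=> a0 x0 xy; have y0 := lt_le_trans x0 xy.
have na : 0 <= - a by rewrite oppr_ge0.
rewrite !pwE// -[a]opprK !(powRN _ (- a)) lef_pV2 ?posrE ?powR_gt0//.
by rewrite ge0_ler_powR// nnegrE ltW.
Qed.
End PwLemmas.

Ltac pos :=
  lazymatch goal with
  | |- forall _, _ => intro; pos
  | |- is_true (@Order.le _ _ _ (mule _ _)) => apply: mule_ge0; pos
  | |- is_true (@Order.le _ _ _ (EFin _)) => rewrite lee_fin; pos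
  | |- is_true (@Order.le _ _ _ (integral _ _ _)) => apply: integral_ge0; pos
  | |- is_true (@Order.le _ _ _ (poweR _ _)) => apply: poweR_ge0
  | |- is_true (@Order.le _ _ _ (GRing.mul _ _)) => apply: mulr_ge0; pos
  | |- is_true (@Order.le _ _ _ (GRing.add _ _)) => first [apply: adde_ge0; pos | apply: addr_ge0; pos]
  | |- is_true (@Order.le _ _ _ (pw _ _)) => apply: pw_ge0
  | |- is_true (@Order.le _ _ _ (powR _ _)) => apply: powR_ge0
  | |- is_true (@Order.le _ _ _ (GRing.inv _)) => rewrite invr_ge0; pos
  | |- is_true (@Order.le _ _ _ (GRing.exp _ _)) => first [by apply: sqr_ge0 | apply: exprn_ge0; pos]
  | |- is_true (@Order.le _ _ _ (GRing.natmul (GRing.one _) _)) => apply: ler0n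
  | |- is_true (@Order.le _ _ _ (Num.sqrt _)) => apply: sqrtr_ge0
  | |- is_true (@Order.le _ _ _ (Num.norm _)) => apply: normr_ge0
  | |- _ => first [done | by apply: ltW | by auto | idtac]
  end.
Ltac side := solve [done | (meas; pos); done | pos; done].

(* The integral of a nonnegative function is a supremum over simple functions below
   it, so monotonicity needs no measurability; suprema over t are never shown measurable. *)
Lemma le_integral_nonmeas d (T : measurableType d) (R : realType)
    (m : {measure set T -> \bar R}) (f g : T -> \bar R) :
  (forall x, 0 <= f x)%E -> (forall x, f x <= g x)%E ->
  (\int[m]_x f x <= \int[m]_x g x)%E.
Proof.
move=> f0 fg; rewrite !ge0_integralTE//; last by move=> x; exact: le_trans (fg x).
apply: ge_ereal_sup => /= _ [h hf <-].
by apply: ereal_sup_ubound; exists h => // x; exact: le_trans (fg x).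
Qed.

Lemma ge0_integralZl_ext (R : realType) (k : \bar R) (f g : R -> \bar R) :
  measurable_fun setT f -> (forall x, 0 <= f x)%E -> (0 <= k)%E ->
  (forall x, g x = k * f x)%E -> (\int[mu]_x g x = k * \int[mu]_x f x)%E.
Proof.
move=> mf f0 k0 gE; rewrite -ge0_integralZl//.
by apply: eq_integral => x _; exact: gE.
Qed.

(** * Affine substitutions on the line, shears and rotations of the plane *)

Section ChangeOfVariables.
Variable R : realType.
Implicit Types f : R -> \bar R.
Local Open Scope ereal_scope.

(** The rescaled pushforward gives every half-open interval its length, and Lebesgue measure is the
    only measure that does. *)
Lemma lebesgue_measure_affine (a b : R) (A : set R) : (0 < a)%R -> measurable A ->
  mu A = a%:E * pushforward mu (fun x : R => (a * x + b)%R : measurableTypeR R) A.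
Proof.
move=> a0 mA.
have mf : measurable_fun setT (fun x : R => (a * x + b)%R : measurableTypeR R) by meas.
rewrite (@lebesgue_measure_unique R (mscale (NngNum (ltW a0)) (pushforward mu (fun x : R => (a * x + b)%R : measurableTypeR R))))//.
move=> _ [[u v]] _ <-.
rewrite [RHS](_ : _ = a%:E * mu ((fun x : R => a * x + b)%R @^-1` `]u, v]))//.
rewrite (_ : _ @^-1` _ = `](u - b) / a, (v - b) / a]%classic)%R; last first.
  apply/seteqP; split => x /=; rewrite !in_itv/= ltr_pdivrMr// ler_pdivlMr// ltrBlDr lerBrDr mulrC//.
rewrite !lebesgue_measure_itv/= !lte_fin ltr_pM2r ?invr_gt0// ltrD2r.
case: ifPn => _; last by rewrite mule0.
by rewrite -!EFinB -EFinM; congr (_%:E); field; rewrite gt_eqF.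
Qed.

Lemma ge0_integral_affine f (a b : R) : (0 < a)%R -> measurable_fun setT f -> (forall x, 0 <= f x) ->
  \int[mu]_x f (a * x + b)%R = (a^-1)%:E * \int[mu]_x f x.
Proof.
move=> a0 mf f0.
have mg : measurable_fun setT (fun x : R => (a * x + b)%R : measurableTypeR R) by meas.
pose phi := (fun x : R => (a * x + b)%R) : measurableTypeR R -> measurableTypeR R.
transitivity (\int[pushforward mu phi]_y f y).
  by rewrite ge0_integral_pushforward//.
rewrite [in RHS](eq_measure_integral (mscale (NngNum (ltW a0)) (pushforward mu phi))).
  by rewrite ge0_integral_mscale//= muleA -EFinM mulVf ?gt_eqF// mul1e.
by move=> A mA _; exact: (lebesgue_measure_affine b a0 mA).
Qed.

Lemma ge0_integral_scale f (a : R) : (0 < a)%R -> measurable_fun setT f -> (forall x, 0 <= f x) ->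
  \int[mu]_x f (a * x)%R = (a^-1)%:E * \int[mu]_x f x.
Proof.
move=> a0 mf f0; rewrite -(ge0_integral_affine 0 a0 mf f0).
by under [RHS]eq_integral do rewrite addr0.
Qed.

Lemma ge0_integral_shift f (b : R) : measurable_fun setT f -> (forall x, 0 <= f x) ->
  \int[mu]_x f (x + b)%R = \int[mu]_x f x.
Proof.
move=> mf f0; have := ge0_integral_affine b ltr01 mf f0.
rewrite invr1 mul1e => <-.
by under [RHS]eq_integral do rewrite mul1r.
Qed.

Lemma ge0_integral_opp f : measurable_fun setT f -> (forall x, 0 <= f x) ->
  \int[mu]_x f (- x)%R = \int[mu]_x f x.
Proof.
move=> mf f0.
have mN : measurable_fun setT (fun x : R => (- x)%R : measurableTypeR R) by meas.
pose phi := (fun x : R => (- x)%R) : measurableTypeR R -> measurableTypeR R.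
transitivity (\int[pushforward mu phi]_y f y).
  by rewrite ge0_integral_pushforward.
apply: eq_measure_integral => A mA _; exact: lebesgue_measureN.
Qed.

Lemma ge0_integral_swap (H : R * R -> \bar R) : measurable_fun setT H -> (forall x, 0 <= H x) ->
  \int[mu]_x \int[mu]_y H (x, y) = \int[mu]_y \int[mu]_x H (x, y).
Proof. by move=> mH H0; exact: fubini_tonelli. Qed.

Section Rotation.
Variable H : R * R -> \bar R.
Hypotheses (mH : measurable_fun setT H) (H0 : forall x, 0 <= H x).

Lemma ge0_integral_shear2 (c : R) :
  \int[mu]_x \int[mu]_y H (x, (y + c * x)%R) = \int[mu]_x \int[mu]_y H (x, y).
Proof.
apply: eq_integral => x _.
by rewrite (@ge0_integral_shift (fun y => H (x, y)))//; meas.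
Qed.
End Rotation.

Lemma ge0_integral_shear1 (H : R * R -> \bar R) (c : R) : measurable_fun setT H -> (forall x, 0 <= H x) ->
  \int[mu]_x \int[mu]_y H ((x + c * y)%R, y) = \int[mu]_x \int[mu]_y H (x, y).
Proof.
move=> mH H0.
etransitivity.
  by apply: (@ge0_integral_swap (fun p => H ((p.1 + c * p.2)%R, p.2))) => //; meas.
etransitivity; last by apply/esym/ge0_integral_swap.
apply: eq_integral => y _.
by rewrite /= (@ge0_integral_shift (fun x => H (x, y)))//; meas.
Qed.

(** For s nonzero a rotation by theta is a product of three shears, with slopes tan (theta/2), - sin
    theta and tan (theta/2), and a shear is a translation in one variable while the other is fixed.
    For s = 0 only the identity and the point reflection remain. *)
Lemma ge0_integral_rotation (H : R * R -> \bar R) (c s : R) : (c ^+ 2 + s ^+ 2 = 1)%R ->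
  measurable_fun setT H -> (forall x, 0 <= H x) ->
  \int[mu]_x \int[mu]_y H ((c * x + s * y)%R, (c * y - s * x)%R) = \int[mu]_x \int[mu]_y H (x, y).
Proof.
move=> cs mH H0.
have [s0|s0] := eqVneq s 0%R.
  subst s.
  under eq_integral do under eq_integral do rewrite !mul0r addr0 subr0.
  have : ((c - 1) * (c + 1) = 0)%R by lra.
  move/eqP; rewrite mulf_eq0 => /orP[|] /eqP ce.
    have -> : c = 1%R by lra.
    by under eq_integral do under eq_integral do rewrite !mul1r.
  have -> : c = (-1)%R by lra.
  under eq_integral do under eq_integral do rewrite !mulN1r.
  etransitivity; first apply: (@ge0_integral_opp (fun x => \int[mu]_y H (x, (- y)%R))).
  - by meas.
  - by move=> x; apply: integral_ge0.
  by apply: eq_integral => x _; rewrite (@ge0_integral_opp (fun y => H (x, y)))//; meas.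
pose tau := ((1 - c) / s)%R.
have e : ((1 - c) * (1 + c) / s = s)%R.
  by rewrite (_ : (1 - c) * (1 + c) = s * s)%R ?mulfK//; lra.
transitivity (\int[mu]_x \int[mu]_y H ((x + tau * y) + tau * (y - s * (x + tau * y)), y - s * (x + tau * y))%R).
  apply: eq_integral => x _; apply: eq_integral => y _; congr (H (_, _)); rewrite /tau.
    by rewrite -[in X in (X * y)%R]e; field.
  by field.
etransitivity.
  apply: (@ge0_integral_shear1 (fun p => H (p.1 + tau * (p.2 - s * p.1), p.2 - s * p.1)%R) tau) => //.
  by meas.
rewrite /=.
under eq_integral do under eq_integral do rewrite -!mulNr.
etransitivity.
  apply: (@ge0_integral_shear2 (fun p => H (p.1 + tau * p.2, p.2)%R) _ _ (- s)%R) => //.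
  by meas.
exact: ge0_integral_shear1.
Qed.
End ChangeOfVariables.

(** * Comparison with boxes, and the dilation-invariant measure dx/x *)

Section Boxes.
Variable R : realType.
Implicit Types f g : R -> \bar R.
Local Open Scope ereal_scope.

Lemma integral_box (a b K : R) : (a <= b)%R -> (0 <= K)%R ->
  \int[mu]_x (((a <= x) && (x <= b))%R%:R * K)%:E = (K * (b - a))%:E.
Proof.
move=> ab K0.
under eq_integral do rewrite EFinM muleC.
rewrite ge0_integralZl/=; [|side ..].
rewrite (_ : (fun x : R => (((a <= x) && (x <= b))%:R)%:E) = (EFin \o \1_(`[a, b]%classic))); last first.
  by apply/funext => x; rewrite /= indicE mem_setE in_itv.
rewrite integral_indic// setIT (_ : K%:E * _ = K%:E * mu `[a, b]%classic)//.
rewrite lebesgue_measure_itv/= lte_fin EFinM.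
case: ltP => // ba; have -> : b = a by apply/eqP; rewrite eq_le ab ba.
by rewrite subrr.
Qed.

Lemma integral_le_box f (a b K : R) : (a <= b)%R -> (0 <= K)%R -> (forall x, 0 <= f x) ->
  (forall x, f x <= (((a <= x) && (x <= b))%R%:R * K)%:E) ->
  \int[mu]_x f x <= (K * (b - a))%:E.
Proof. by move=> ab K0 f0 fle; rewrite -integral_box//; apply: le_integral_nonmeas. Qed.

Lemma integral_ge_box f (a b K : R) : (a <= b)%R -> (0 <= K)%R -> (forall x, 0 <= f x) ->
  (forall x, (a <= x <= b)%R -> K%:E <= f x) ->
  (K * (b - a))%:E <= \int[mu]_x f x.
Proof.
move=> ab K0 f0 fge; rewrite -integral_box//; apply: le_integral_nonmeas => x.
  by rewrite lee_fin mulr_ge0.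
case: (boolP (_ && _)) => [/fge|_]; first by rewrite mul1r.
by rewrite mul0r.
Qed.

Lemma ge0_integral_haar f (a : R) : (0 < a)%R -> measurable_fun setT f -> (forall x, 0 <= f x) ->
  \int[mu]_x (f (a * x)%R * (pw (-1) x)%:E) = \int[mu]_x (f x * (pw (-1) x)%:E).
Proof.
move=> a0 mf f0.
transitivity (\int[mu]_x (a%:E * (f (a * x)%R * (pw (-1) (a * x)%R)%:E))).
  apply: eq_integral => x _; rewrite pwM// (pwE _ a0) powR_inv1 ?ltW//.
  by rewrite muleCA -EFinM mulrA mulfV ?gt_eqF// mul1r.
rewrite ge0_integralZl/=; [|side ..].
rewrite (@ge0_integral_scale _ (fun x => f x * (pw (-1) x)%:E)); [|side ..].
by rewrite muleA -EFinM mulfV ?gt_eqF// mul1e.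
Qed.

(** This follows the uniqueness proof for Haar measure. The kernel of r^2 <= w <= 4 r^2, integrated
    with G(w) against dr/r dw/w in both orders, gives c1 times the left integral and c2 times the
    right one. Crude boxes show that c1 and c2 are positive and finite, so their ratio is the
    constant and no derivative is taken. *)
Lemma integral_sqr_haar : exists2 k : R, (0 < k)%R & forall G : R -> \bar R,
  measurable_fun setT G -> (forall x, 0 <= G x) ->
  \int[mu]_r (G (r ^+ 2)%R * (pw (-1) r)%:E) = k%:E * \int[mu]_w (G w * (pw (-1) w)%:E).
Proof.
pose c1 : \bar R := \int[mu]_w (((1 <= w) && (w <= 4))%R%:R%:E * (pw (-1) w)%:E).
pose c2 : \bar R := \int[mu]_r (((r ^+ 2 <= 1) && (1 <= 4 * r ^+ 2))%R%:R%:E * (pw (-1) r)%:E).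
have c1le : c1 <= (1 * (4 - 1))%:E.
  apply: integral_le_box; [lra|lra|side|move=> x].
  rewrite -EFinM lee_fin; case: (boolP (_ && _)) => [/andP[x1 _]|_]; last by rewrite !mul0r.
  rewrite !mul1r (le_trans (ger_pw (_ : -1 <= 0)%R _ x1))//.
  by rewrite pwE// powR1.
have c1ge : (4^-1 * (4 - 1))%:E <= c1.
  apply: integral_ge_box; [lra|lra|side|move=> x /andP[x1 x4]].
  rewrite -EFinM x1 x4 lee_fin mul1r.
  rewrite (le_trans _ (ger_pw (_ : -1 <= 0)%R _ x4))//; last lra.
  by rewrite pwE// powR_inv1.
have c2le : c2 <= (2 * (1 - 2^-1))%:E.
  apply: integral_le_box; [lra|lra|side|move=> x].
  rewrite -EFinM lee_fin; have [x0|x0] := lerP x 0; first by rewrite pw_le0// mulr0 mulr_ge0.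
  case: (boolP (_ && (1 <= 4 * _)%R)) => [/andP[x1 x4]|_]; last by rewrite !mul0r mulr_ge0.
  have -> : ((2^-1 <= x) && (x <= 1))%R by apply/andP; split; nra.
  have h2 : (2 = pw (-1) (2^-1) :> R)%R by rewrite pwE ?invr_gt0// powR_inv1 ?invr_ge0// invrK.
  rewrite !mul1r [X in (_ <= X)%R]h2; apply: ger_pw; [lra|lra|nra].
have c2ge : (1 * (1 - 2^-1))%:E <= c2.
  apply: integral_ge_box; [lra|lra|side|move=> x /andP[x1 x4]].
  rewrite -EFinM lee_fin.
  have -> : ((x ^+ 2 <= 1) && (1 <= 4 * x ^+ 2))%R by apply/andP; split; nra.
  rewrite mul1r (le_trans _ (ger_pw (_ : -1 <= 0)%R _ x4))//; last lra.
  by rewrite pwE// powR1.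
have c1f : c1 \is a fin_num.
  by rewrite ge0_fin_numE ?(le_lt_trans c1le) ?ltry// (le_trans _ c1ge)// lee_fin; lra.
have c2f : c2 \is a fin_num.
  by rewrite ge0_fin_numE ?(le_lt_trans c2le) ?ltry// (le_trans _ c2ge)// lee_fin; lra.
have c10 : (0 < fine c1)%R by rewrite -lte_fin fineK// (lt_le_trans _ c1ge)// lte_fin; lra.
have c20 : (0 < fine c2)%R by rewrite -lte_fin fineK// (lt_le_trans _ c2ge)// lte_fin; lra.
exists (fine c2 / fine c1)%R; first by rewrite divr_gt0.
move=> G mG G0.
have pwE0 x : 0 <= (pw (-1) x : R)%:E by rewrite lee_fin pw_ge0.
suff H : c1 * \int[mu]_r (G (r ^+ 2)%R * (pw (-1) r)%:E) = c2 * \int[mu]_w (G w * (pw (-1) w)%:E).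
  rewrite mulrC EFinM fineK// -muleA -H muleA -[in X in _ = _ * X * _](fineK c1f) -EFinM mulVf ?mul1e//.
  by rewrite gt_eqF.
have c2pos : 0 <= c2 by rewrite /c2; side.
pose F (p : R * R) := G p.2 * (((p.1 ^+ 2 <= p.2) && (p.2 <= 4 * p.1 ^+ 2))%R%:R%:E) * (pw (-1) p.2)%:E * (pw (-1) p.1)%:E.
have mF : measurable_fun setT F by rewrite /F; meas.
have F0 p : 0 <= F p by rewrite /F !mule_ge0.
transitivity (\int[mu]_r \int[mu]_w F (r, w)).
(* For fixed w, dilating r by sqrt w turns G(r^2) into G(w r^2); after the exchange, for fixed r,
   dilating w by r^2 produces the kernel of F. *)
- transitivity (\int[mu]_w \int[mu]_r (G (w * r ^+ 2)%R * (((1 <= w) && (w <= 4))%R%:R%:E) * (pw (-1) w)%:E * (pw (-1) r)%:E)).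
    rewrite muleC -ge0_integralZl/=; [|side ..].
    apply: eq_integral => w _.
    have [w0|w0] := lerP w 0.
      rewrite pw_le0// !mule0 integral0_eq// => x _; by rewrite mule0 mul0e.
    have sw0 : (0 < Num.sqrt w)%R by rewrite sqrtr_gt0.
    rewrite -(@ge0_integral_haar (fun r => G (r ^+ 2)%R) (Num.sqrt w))//=; [|side ..].
    rewrite muleC -ge0_integralZl/=; [|side ..].
    apply: eq_integral => r _; rewrite exprMn sqr_sqrtr ?(ltW w0)//.
    by rewrite [LHS]muleCA -!muleA.
  etransitivity.
    apply: (@ge0_integral_swap _ (fun p => G (p.1 * p.2 ^+ 2)%R * (((1 <= p.1) && (p.1 <= 4))%R%:R%:E) * (pw (-1) p.1)%:E * (pw (-1) p.2)%:E)); side.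
  apply: eq_integral => r _ /=.
  have [r0|r0] := lerP r 0.
    by rewrite /F/= pw_le0// !integral0_eq// => x _; rewrite mule0.
  rewrite /F/=.
  rewrite !ge0_integralZr/=; [|side ..].
  congr (_ * _).
  have r20 : (0 < r ^+ 2)%R by rewrite exprn_gt0.
  rewrite -(@ge0_integral_haar (fun w => G w * (((r ^+ 2 <= w) && (w <= 4 * r ^+ 2))%R%:R%:E)) _ r20)//=; [|side ..].
  apply: eq_integral => w _; rewrite mulrC; congr (_ * _%:R%:E * _).
  by rewrite ler_pMr// mulrC ler_pM2r.
- rewrite ge0_integral_swap//.
  rewrite muleC -ge0_integralZr/=; [|side ..].
  apply: eq_integral => w _; rewrite /F/=.
  have [w0|w0] := lerP w 0.
    by rewrite pw_le0// !mule0 mul0e integral0_eq// => x _; rewrite mule0 mul0e.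
  have sw0 : (0 < Num.sqrt w)%R by rewrite sqrtr_gt0.
  rewrite /c2.
  rewrite [in RHS](_ : (fun r => _) = (fun r => (fun r => ((r ^+ 2 <= w) && (w <= 4 * r ^+ 2))%R%:R%:E) (Num.sqrt w * r)%R * (pw (-1) r)%:E)); last first.
    apply/funext => r; congr (_%:R%:E * _); rewrite exprMn sqr_sqrtr ?(ltW w0)//.
    have e1 : (w * r ^+ 2 <= w)%R = (r ^+ 2 <= 1)%R by rewrite ger_pMr.
    have e2 : (w <= 4 * (w * r ^+ 2))%R = (1 <= 4 * r ^+ 2)%R by rewrite mulrCA ler_pMr.
    by rewrite e1 e2.
  rewrite (@ge0_integral_haar (fun r => ((r ^+ 2 <= w) && (w <= 4 * r ^+ 2))%R%:R%:E))//; last by meas.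
  rewrite -ge0_integralZl/=; [|side ..].
  apply: eq_integral => r _; rewrite -!muleA; congr (_ * _); by rewrite muleCA.
Qed.

End Boxes.

(** * Finiteness of power and beta integrals *)

Section PowerIntegrals.
Variable R : realType.
Implicit Types f g : R -> \bar R.
Local Open Scope ereal_scope.

Lemma eq_integral_but f g (a : R) : measurable_fun setT f -> measurable_fun setT g ->
  (forall x, 0 <= f x) -> (forall x, 0 <= g x) -> (forall x, x != a -> f x = g x) ->
  \int[mu]_x f x = \int[mu]_x g x.
Proof.
move=> mf mg f0 g0 fg; apply: ge0_ae_eq_integral => //.
exists [set a]; split => //; first exact: lebesgue_measure_set1.
move=> x /= H; apply: contrapT => xa; apply: H => _; apply: fg; exact/eqP.
Qed.

Lemma integral_even_half (G : R -> \bar R) : measurable_fun setT G -> (forall x, 0 <= G x) ->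
  \int[mu]_v G (v ^+ 2)%R = 2%:E * \int[mu]_v (G (v ^+ 2)%R * ((0 < v)%R%:R)%:E).
Proof.
move=> mG G0.
have -> : 2%:E = 1 + 1 :> \bar R by rewrite -EFinD.
rewrite ge0_muleDl// mul1e.
rewrite -[X in _ = X + _]ge0_integral_opp; [|side ..].
rewrite -ge0_integralD/=; [|side ..].
apply: (@eq_integral_but _ _ 0%R); [side ..|move=> x x0].
rewrite sqrrN oppr_gt0; case: ltgtP x0 => //= xx _.
  by rewrite mule1 mule0 adde0.
by rewrite mule1 mule0 add0e.
Qed.

(** Writing dv = v dv/v moves a factor v = w^(1/2) into G, which reduces the claim to the
    multiplicative version. *)
Lemma integral_sqr : exists2 k : R, (0 < k)%R & forall G : R -> \bar R,
  measurable_fun setT G -> (forall x, 0 <= G x) ->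
  \int[mu]_v G (v ^+ 2)%R = k%:E * \int[mu]_w (G w * (pw (- 2^-1) w)%:E).
Proof.
have [k k0 H] := integral_sqr_haar R.
exists (2 * k)%R; first by rewrite mulr_gt0.
move=> G mG G0; rewrite integral_even_half// EFinM -muleA; congr (_ * _).
have -> : (- 2^-1 = 2^-1 - 1 :> R)%R by lra.
under [in RHS]eq_integral do rewrite pwD EFinM muleA.
rewrite -H; [|side ..].
apply: eq_integral => v _; rewrite -muleA -EFinM; congr (_ * _%:E).
have [v0|v0] := lerP v 0; first by rewrite (pw_le0 _ v0) mulr0.
rewrite expr2 pwM// -!pwD (_ : _ + _ + _ = 0 :> R)%R ?pw0//; lra.
Qed.

(** Its value is 1/s for s > 0; only its positivity and finiteness are established. *)
Definition pint (s : R) : \bar R := \int[mu]_x (((x < 1)%R%:R)%:E * (pw (s - 1) x)%:E).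

Lemma pint_ge0 s : 0 <= pint s.
Proof. rewrite /pint; side. Qed.

(** Squaring the variable gives pint (2 s) = k pint s. Finiteness is clear for s >= 1, where the
    integrand is bounded, and it descends to every s > 0 by repeated halving. *)
Lemma pint_lty s : (0 < s)%R -> pint s < +oo.
Proof.
have H1 t : (1 <= t)%R -> pint t < +oo.
  move=> t1; apply: (@le_lt_trans _ _ (1 * (1 - 0))%:E); last exact: ltry.
  apply: integral_le_box; [lra|lra|side|move=> x].
  rewrite -EFinM lee_fin; have [x0|x0] := lerP x 0.
    by rewrite pw_le0// mulr0; pos.
  case: ltP => x1; last by rewrite mul0r; pos.
  rewrite (ltW x0) (ltW x1)/= !mul1r.
  apply: (@le_trans _ _ (pw (t - 1) 1)); last by rewrite pwE// powR1.
  by apply: ler_pw; lra.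
have [k k0 H] := integral_sqr_haar R.
have H2 t : pint (t * 2) = k%:E * pint t.
  have := H (fun w => ((w < 1)%R%:R)%:E * (pw t w)%:E).
  move=> HH.
  have -> : pint t = \int[mu]_w (((w < 1)%R%:R)%:E * (pw t w)%:E * (pw (-1) w)%:E).
    by apply: eq_integral => x _; rewrite pwD EFinM muleA.
  etransitivity; last by apply: HH; side.
  apply: eq_integral => r _; rewrite -muleA -!EFinM.
  have [r0|r0] := lerP r 0; first by rewrite !(pw_le0 _ r0) !mulr0.
  rewrite pwD mulrA mulrA; congr (_ * _)%:E.
  have -> : (r ^+ 2 < 1)%R = (r < 1)%R by rewrite expr_lt1// ltW.
  by congr (_ * _)%R; rewrite expr2 pwM// -pwD; congr pw; lra.
have H3 m : forall t, (1 <= t * 2 ^+ m)%R -> pint t < +oo.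
  elim: m => [|m IH] t; first by rewrite expr0 mulr1; exact: H1.
  rewrite exprS mulrA => /IH; rewrite H2.
  have := pint_ge0 t; case: (pint t) => [r _ _|_|//]; first exact: ltry.
  by rewrite gt0_muley// lte_fin.
move=> s0.
have /(_ (s^-1)%R)[m] : forall y : R, exists m : nat, (y <= 2 ^+ m)%R.
  move=> y; exists (Num.truncn y).+1.
  rewrite (le_trans (ltW (truncnS_gt y)))//.
  by rewrite -natrX ler_nat ltnW// ltn_expl.
move=> ym; apply: (H3 m).
by rewrite mulrC -ler_pdivrMr// mul1r.
Qed.

Lemma pint_gt0 s : 0 < pint s.
Proof.
have h0 : (0 < pw (s - 1) (2^-1) :> R)%R by rewrite pw_gt0// invr_gt0.
have h1 : (0 < pw (s - 1) (3 / 4) :> R)%R by rewrite pw_gt0//; lra.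
pose K := Num.min (pw (s - 1) (2^-1)) (pw (s - 1) (3/4) : R).
have K0 : (0 < K)%R by rewrite /K lt_min h0 h1.
apply: (@lt_le_trans _ _ (K * (3 / 4 - 2^-1))%:E); first by rewrite lte_fin mulr_gt0//; lra.
apply: integral_ge_box; [lra|exact: ltW|side|move=> x /andP[x1 x2]].
have -> : (x < 1)%R by lra.
rewrite mul1e lee_fin /K ge_min; have [s1|s1] := lerP 0 (s - 1).
  by rewrite ler_pw.
by apply/orP; right; apply: ger_pw; lra.
Qed.

Lemma pint_fin s : (0 < s)%R -> pint s \is a fin_num.
Proof. by move=> s0; rewrite ge0_fin_numE ?pint_ge0// pint_lty. Qed.

Lemma integral_pw_lt s (L : R) : (0 <= L)%R -> (0 < s)%R ->
  \int[mu]_x (((x < L)%R%:R)%:E * (pw (s - 1) x)%:E) = (pw s L)%:E * pint s.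
Proof.
rewrite le_eqVlt => /predU1P[<-|L0] s0.
  rewrite pw_le0// mul0e integral0_eq// => x _.
  by case: ltP => x0; rewrite ?mul0e// pw_le0 ?mule0// ltW.
etransitivity; last first.
  apply: (@ge0_integralZl_ext _ _ (fun x => ((x < 1)%R%:R)%:E * (pw (s - 1) x)%:E) (fun x => ((L * x < L)%R%:R)%:E * (pw s (L * x))%:E * (pw (-1) x)%:E)); [side..|move=> x].
  by rewrite gtr_pMr// (pwM _ _ L0) pwD !EFinM -!muleA muleCA.
etransitivity; last by apply/esym/(@ge0_integral_haar _ (fun x => ((x < L)%R%:R)%:E * (pw s x)%:E) L L0); side.
by apply: eq_integral => x _; rewrite pwD EFinM muleA.
Qed.

(** At each v in (-1, 1) one of 1 - v and 1 + v lies in [1, 2], so its power is at most K; what is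
    left is an integrable power singularity at a single endpoint. *)
Lemma integral_beta_lty (a b : R) : (-1 < a)%R -> (-1 < b)%R ->
  \int[mu]_v (pw a (1 - v) * pw b (1 + v))%:E < +oo.
Proof.
move=> a1 b1.
pose K c : R := (Num.max (pw c 1) (pw c 2))%R.
have K0 c : (0 <= K c)%R by rewrite le_max pw_ge0.
have KE (c x : R) : (1 <= x <= 2)%R -> (pw c x <= K c)%R.
  move=> /andP[x1 x2]; rewrite le_max; have [c0|c0] := lerP 0 c.
    by apply/orP; right; apply: ler_pw.
  by apply/orP; left; apply: ger_pw; lra.
have I2 (c : R) : (-1 < c)%R -> \int[mu]_x (((x < 2)%R%:R)%:E * (pw c x)%:E) < +oo.
  move=> c1; have c10 : (0 < c + 1)%R by lra.
  have := @integral_pw_lt (c + 1)%R 2 (ler0n _ _) c10.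
  rewrite addrK => ->.
  by rewrite lte_mul_pinfty ?lee_fin ?pw_ge0 ?pint_lty.
have mI (c : R) : measurable_fun setT (fun x : R => (((x < 2)%R%:R)%:E * (pw c x)%:E)) by meas.
have pI (c x : R) : 0 <= (((x < 2)%R%:R)%:E * (pw c x)%:E) by pos.
apply: (@le_lt_trans _ _ (\int[mu]_v ((K b)%:E * (((1 - v < 2)%R%:R)%:E * (pw a (1 - v))%:E) +
   (K a)%:E * (((v + 1 < 2)%R%:R)%:E * (pw b (v + 1))%:E)))).
  apply: le_integral_nonmeas => v; first by pos.
  rewrite -!EFinM -EFinD lee_fin (addrC v 1%R).
  have [v1|v1] := lerP (1 - v) 0.
    by rewrite (pw_le0 _ v1) mul0r !mulr0 add0r; pos.
  have [v2|v2] := lerP (1 + v) 0.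
    by rewrite (pw_le0 _ v2) !mulr0 addr0; pos.
  have -> : (1 - v < 2)%R by lra.
  have -> : (1 + v < 2)%R by lra.
  rewrite !mul1r; have [v0|v0] := lerP 0 v.
    rewrite ler_wpDr//; first by pos.
    by rewrite mulrC ler_wpM2r ?pw_ge0// KE//; lra.
  rewrite ler_wpDl//; first by pos.
  by rewrite ler_wpM2r ?pw_ge0// KE//; lra.
rewrite ge0_integralD/=; [|side ..].
rewrite !ge0_integralZl/=; [|side ..].
rewrite (@ge0_integral_shift _ (fun v => (((v < 2)%R%:R)%:E * (pw b v)%:E)))//.
have -> : \int[mu]_v (((1 - v < 2)%R%:R)%:E * (pw a (1 - v))%:E) = \int[mu]_x (((x < 2)%R%:R)%:E * (pw a x)%:E).
  etransitivity; last by apply: (@ge0_integral_shift _ _ 1%R).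
  etransitivity; last by apply: ge0_integral_opp; side.
  by apply: eq_integral => x _; rewrite addrC.
by apply: lte_add_pinfty; rewrite lte_mul_pinfty ?lee_fin ?I2.
Qed.

End PowerIntegrals.

(** * Polar coordinates for iterated integrals of functions of x.s and |s|^2 *)

Section Radial.
Variable R : realType.
Local Open Scope ereal_scope.

Fixpoint sqs (s : seq R) : R := if s is x :: s' then (x ^+ 2 + sqs s')%R else 0%R.
Fixpoint sdot (xs s : seq R) : R :=
  match xs, s with x :: xs', y :: s' => (x * y + sdot xs' s')%R | _, _ => 0%R end.

Definition iint_sq n (g : R -> \bar R) : \bar R := iint n (fun s => g (sqs s)).

Lemma iint_ge0 n (F : seq R -> \bar R) : (forall s, 0 <= F s) -> 0 <= iint n F.
Proof. by elim: n F => [|n IH] F F0 //=; apply: integral_ge0 => x _; apply: IH. Qed.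

Lemma le_iint n (F G : seq R -> \bar R) : (forall s, 0 <= F s) ->
  (forall s, F s <= G s) -> iint n F <= iint n G.
Proof.
elim: n F G => [|n IH] F G F0 FG //=; apply: le_integral_nonmeas => x.
  exact: iint_ge0.
exact: IH.
Qed.

Lemma iint_sq_ge0 n g : (forall w, 0 <= g w) -> 0 <= iint_sq n g.
Proof. by move=> g0; apply: iint_ge0. Qed.

Lemma measurable_iint_sq n d (T : measurableType d) (G : T * R -> \bar R) :
  measurable_fun setT G -> (forall p, 0 <= G p) ->
  measurable_fun setT (fun t => iint_sq n (fun w => G (t, w))).
Proof.
elim: n d T G => [|n IH] d T G mG G0; first by rewrite /iint_sq/=; meas.
rewrite /iint_sq/=.
apply: (@measurable_inner _ _ _ (fun p => iint n (fun s => G (p.1, (p.2 ^+ 2 + sqs s)%R)))).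
  apply: (IH _ _ (fun q : (T * R) * R => G (q.1.1, (q.1.2 ^+ 2 + q.2)%R))) => //; meas.
by move=> x; apply: iint_ge0.
Qed.

(* Rotating one coordinate axis onto xs, one plane rotation at a time. *)
Lemma iint_sdot n (xs : seq R) (r : R) (G : R * R -> \bar R) :
  size xs = n.+1 -> (0 <= r)%R -> (r ^+ 2 = sqs xs)%R ->
  measurable_fun setT G -> (forall p, 0 <= G p) ->
  iint n.+1 (fun s => G (sdot xs s, sqs s)) =
  \int[mu]_u iint_sq n (fun w => G ((r * u)%R, (u ^+ 2 + w)%R)).
Proof.
elim: n xs r G => [|n IH] [|x xs] r G sx; try discriminate sx; move: sx => /= [sxs] r0 rE mG G0.
  case: xs sxs rE => [|? ?] sx; [|discriminate sx]; move=> /= rE; rewrite /iint_sq/=.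
  under eq_integral do rewrite !addr0.
  under [in RHS]eq_integral do rewrite !addr0.
  have [x0|x0] := lerP 0%R x.
    have -> : r = x by nra.
    by [].
  have -> : r = (- x)%R by nra.
  rewrite -[RHS]ge0_integral_opp; [|side ..].
  by apply: eq_integral => u _; rewrite mulrNN sqrrN.
pose r' := Num.sqrt (sqs xs).
have sq0 : (0 <= sqs xs)%R.
  by elim: (xs) => //= y s IHs; rewrite addr_ge0// sqr_ge0.
have r'E : (r' ^+ 2 = sqs xs)%R by rewrite sqr_sqrtr.
(* (c, s) is the direction of the vector (x, r') of length r. When r = 0 that vector vanishes and
   any unit vector will do. *)
have [c [s [cs [xE r'c]]]] : exists c s : R, (c ^+ 2 + s ^+ 2 = 1 /\ x = r * c /\ r' = r * s)%R.
  have [re|re] := eqVneq r 0%R.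
    exists 1%R, 0%R; subst r.
    have r'0 : (0 <= r')%R by rewrite sqrtr_ge0.
    by rewrite !mul0r; split; [lra|split; nra].
  exists (x / r)%R, (r' / r)%R; split; last by split; field.
  by rewrite !expr_div_n -mulrDl r'E -rE divff// expf_eq0/= re.
pose H (p : R * R) := iint_sq n (fun w => G ((r * p.1)%R, (p.1 ^+ 2 + (p.2 ^+ 2 + w))%R)).
have mH : measurable_fun setT H.
  apply: (@measurable_iint_sq _ _ _ (fun q : (R * R) * R => G ((r * q.1.1)%R, (q.1.1 ^+ 2 + (q.1.2 ^+ 2 + q.2))%R))) => //; meas.
have H0 p : 0 <= H p by apply: iint_sq_ge0.
(* The induction hypothesis replaces the tail by its own axis variable u. One rotation in the (v, u)
   plane then merges the two, since r (c v + s u) = x v + r' u. *)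
transitivity (\int[mu]_x \int[mu]_y H (x, y)); last by [].
rewrite -(ge0_integral_rotation cs mH H0).
apply: eq_integral => v _.
transitivity (\int[mu]_u iint_sq n (fun w => G ((x * v + r' * u)%R, (v ^+ 2 + (u ^+ 2 + w))%R))).
  apply: (IH xs r' (fun p : R * R => G ((x * v + p.1)%R, (v ^+ 2 + p.2)%R))) => //; first by rewrite sqrtr_ge0.
  by meas.
apply: eq_integral => u _; rewrite /H/=; congr (iint_sq _ _); apply/funext => w.
congr (G (_, _)); first by rewrite xE r'c; ring.
rewrite !addrA; congr (_ + _)%R.
transitivity ((c ^+ 2 + s ^+ 2) * (v ^+ 2 + u ^+ 2))%R; last by ring.
by rewrite cs mul1r.
Qed.

(* The substitution m = u^2 + w, u = sqrt m * v. *)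
Lemma ge0_integral_polar (G : R * R -> \bar R) (a : R) :
  measurable_fun setT G -> (forall p, 0 <= G p) ->
  \int[mu]_u \int[mu]_w (G (u, (u ^+ 2 + w)%R) * (pw a w)%:E) =
  \int[mu]_m ((pw (a + 2^-1) m)%:E *
     \int[mu]_v (G ((Num.sqrt m * v)%R, m) * (pw a (1 - v ^+ 2))%:E)).
Proof.
move=> mG G0.
transitivity (\int[mu]_u \int[mu]_m (G (u, m) * (pw a (m - u ^+ 2))%:E)).
  apply: eq_integral => u _.
  rewrite -(@ge0_integral_shift _ (fun m => G (u, m) * (pw a (m - u ^+ 2))%:E) (u ^+ 2)%R); [|side ..].
  by apply: eq_integral => w _; rewrite addrK addrC.
rewrite (@ge0_integral_swap _ (fun p => G p * (pw a (p.2 - p.1 ^+ 2))%:E)); [|side ..].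
apply: eq_integral => m _ /=.
have [m0|m0] := lerP m 0.
  rewrite pw_le0// mul0e integral0_eq// => u _.
  by rewrite pw_le0 ?mule0// subr_le0 (le_trans m0)// sqr_ge0.
have sm0 : (0 < Num.sqrt m)%R by rewrite sqrtr_gt0.
have -> : (pw (a + 2^-1) m)%:E = (Num.sqrt m)%:E * (pw a m)%:E :> \bar R.
  by rewrite -EFinM pwD mulrC (pwE (2^-1) m0) powR12_sqrt ?(ltW m0).
rewrite -muleA -[in RHS]ge0_integralZl/=; [|side ..].
transitivity ((Num.sqrt m)%:E * \int[mu]_v (G ((Num.sqrt m * v)%R, m) * (pw a (m - (Num.sqrt m * v) ^+ 2))%:E)).
  rewrite (@ge0_integral_scale _ (fun u => G (u, m) * (pw a (m - u ^+ 2))%:E) _ sm0); [|side ..].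
  by rewrite muleA -EFinM mulfV ?mul1e// gt_eqF.
congr (_ * _); apply: eq_integral => v _.
rewrite exprMn sqr_sqrtr ?(ltW m0)// muleCA; congr (_ * _).
by rewrite -EFinM -pwM//; congr (pw _ _)%:E; ring.
Qed.

Lemma pw_1Bsqr (a v : R) : (pw a (1 - v ^+ 2) = pw a (1 - v) * pw a (1 + v))%R.
Proof.
have -> : (1 - v ^+ 2 = (1 - v) * (1 + v))%R by ring.
have [v1|v1] := ltrP 0%R (1 - v)%R; first by rewrite pwM.
rewrite (pw_le0 _ v1) mul0r pw_le0//; nra.
Qed.

(** With d = n + 2 the exponent is (d - 3)/2, so this is the total mass of the angular weight. *)
Definition sconst (n : nat) : \bar R := \int[mu]_v (pw (n.+1%:R / 2 - 1) (1 - v ^+ 2))%:E.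

Lemma half_gtN1 (n : nat) : (-1 < n.+1%:R / 2 - 1 :> R)%R.
Proof. by have : (0 < n.+1%:R :> R)%R by []; lra. Qed.

Lemma sconst_lty n : sconst n < +oo.
Proof.
rewrite /sconst; under eq_integral do rewrite pw_1Bsqr.
by apply: integral_beta_lty; exact: half_gtN1.
Qed.

Lemma sconst_gt0 n : 0 < sconst n.
Proof.
pose a : R := (n.+1%:R / 2 - 1)%R.
pose K := Num.min (pw a 1) (pw a (3/4)) : R.
have h1 : (0 < pw a 1 :> R)%R by rewrite pw_gt0.
have h2 : (0 < pw a (3/4) :> R)%R by rewrite pw_gt0//; lra.
have K0 : (0 < K)%R by rewrite lt_min h1 h2.
apply: (@lt_le_trans _ _ (K * (2^-1 - 0))%:E); first by rewrite lte_fin mulr_gt0//; lra.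
apply: integral_ge_box; [lra|exact: ltW|side|move=> v /andP[v0 v1]].
rewrite lee_fin /K ge_min; have [a0|a0] := lerP 0 a.
  by apply/orP; right; apply: ler_pw => //; nra.
by apply/orP; left; apply: ger_pw; [exact: ltW|nra|nra].
Qed.

Lemma sconst_fin n : sconst n \is a fin_num.
Proof. by rewrite ge0_fin_numE ?sconst_lty// ltW// sconst_gt0. Qed.

(** Induction on the dimension: adding a coordinate v and passing to m = v^2 + w raises the exponent
    of the density by 1/2 and multiplies the constant by [sconst n]. *)
Lemma iint_sqE n : exists2 k : R, (0 < k)%R & forall g : R -> \bar R,
  measurable_fun setT g -> (forall w, 0 <= g w) ->
  iint_sq n.+1 g = k%:E * \int[mu]_w (g w * (pw (n.+1%:R / 2 - 1) w)%:E).
Proof.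
elim: n => [|n [k k0 IH]].
  have [k k0 H] := integral_sqr R; exists k; [by []|move=> g mg g0].
  rewrite (_ : 1 / 2 - 1 = - 2^-1 :> R)%R; last lra.
  rewrite -H// /iint_sq/=.
  by under eq_integral do rewrite addr0.
exists (k * fine (sconst n))%R.
  by rewrite mulr_gt0// -lte_fin fineK ?sconst_fin ?sconst_gt0.
move=> g mg g0.
have E : iint_sq n.+2 g = \int[mu]_v iint_sq n.+1 (fun w => g (v ^+ 2 + w)%R) by [].
rewrite {}E; under eq_integral => v _.
  rewrite IH//; last by meas.
  over.
rewrite ge0_integralZl/=; [|side ..].
rewrite (@ge0_integral_polar (fun p => g p.2)); [|side ..].
rewrite EFinM -muleA; congr (_ * _); rewrite fineK ?sconst_fin// -ge0_integralZl/=; [|by []|side|side|by rewrite ltW// sconst_gt0].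
apply: eq_integral => m _.
rewrite ge0_integralZl/=; [|side ..].
have -> : (n.+2%:R / 2 - 1 = n.+1%:R / 2 - 1 + 2^-1 :> R)%R by rewrite -(natr1 n.+1); lra.
by rewrite -/(sconst n) [LHS]muleA [LHS]muleC; congr (_ * _); rewrite muleC.
Qed.

(** One coordinate is put along xs; the other n + 1 enter only through their sum of squares. Then m
    is the squared norm and v the cosine of the angle with xs. *)
Lemma iint_sphere n : exists2 k : R, (0 < k)%R & forall (xs : seq R) (r : R) (G : R * R -> \bar R),
  size xs = n.+2 -> (0 <= r)%R -> (r ^+ 2 = sqs xs)%R ->
  measurable_fun setT G -> (forall p, 0 <= G p) ->
  iint n.+2 (fun s => G (sdot xs s, sqs s)) =
  k%:E * \int[mu]_m ((pw (n.+1%:R / 2 - 2^-1) m)%:E *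
     \int[mu]_v (G ((r * (Num.sqrt m * v))%R, m) * (pw (n.+1%:R / 2 - 1) (1 - v ^+ 2))%:E)).
Proof.
have [k k0 H] := iint_sqE n; exists k; [by []|move=> xs r G sxs r0 rE mG G0].
rewrite (iint_sdot sxs r0 rE mG G0).
have -> : (n.+1%:R / 2 - 2^-1 = n.+1%:R / 2 - 1 + 2^-1 :> R)%R by lra.
under eq_integral => u _.
  rewrite H; [|by meas|by []].
  over.
transitivity (k%:E * \int[mu]_u \int[mu]_w (G ((r * u)%R, (u ^+ 2 + w)%R) * (pw (n.+1%:R / 2 - 1) w)%:E)).
  apply: ge0_integralZl_ext.
  - meas; pos.
  - by pos.
  - by rewrite lee_fin ltW.
  - by [].
congr (k%:E * _).
apply: (@ge0_integral_polar (fun p => G ((r * p.1)%R, p.2))); first by meas.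
by move=> p; exact: G0.
Qed.
End Radial.

(** * Radial functions and their Borel profiles *)

Section Profiles.
Variables (R : realType) (n : nat).
Local Notation d := n.+2.
Implicit Types (x y z : 'rV[R]_d) (psi : R -> R).

Definition row_seq x : seq R := [seq x 0 i | i <- enum 'I_d].

Lemma size_row_seq x : size (row_seq x) = d.
Proof. by rewrite size_map size_enum_ord. Qed.

Lemma nth_row_seq x (i : 'I_d) : nth 0 (row_seq x) i = x 0 i.
Proof.
by rewrite (nth_map i) ?size_enum_ord// nth_ord_enum.
Qed.

Lemma sqsE (s : seq R) : sqs s = \sum_(i < size s) (nth 0 s i) ^+ 2.
Proof.
elim: s => [|a s IH] /=; first by rewrite big_ord0.
by rewrite big_ord_recl/= IH.
Qed.

Lemma sdotE (s t : seq R) : size s = size t -> sdot s t = \sum_(i < size s) nth 0 s i * nth 0 t i.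
Proof.
elim: s t => [|a s IH] [|b t]//= => [_|[st]]; first by rewrite big_ord0.
by rewrite big_ord_recl/= IH.
Qed.

Definition seq_row (s : seq R) : 'rV[R]_d := \row_(i < d) nth 0 s i.

Lemma enorm_ge0 x : 0 <= enorm x. Proof. exact: sqrtr_ge0. Qed.

Lemma enorm_sqr x : enorm x ^+ 2 = \sum_(i < d) x 0 i ^+ 2.
Proof. by rewrite sqr_sqrtr// sumr_ge0// => i _; exact: sqr_ge0. Qed.

Lemma enorm_row_seq x : enorm x ^+ 2 = sqs (row_seq x).
Proof.
by rewrite enorm_sqr sqsE size_row_seq; apply: eq_bigr => i _; rewrite nth_row_seq.
Qed.

Lemma enorm_seq_row (s : seq R) : size s = d -> enorm (seq_row s) ^+ 2 = sqs s.
Proof.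
by move=> ss; rewrite enorm_sqr sqsE ss; apply: eq_bigr => i _; rewrite mxE.
Qed.

Lemma enorm_seq_rowE (s : seq R) : size s = d -> enorm (seq_row s) = Num.sqrt (sqs s).
Proof. by move=> ss; rewrite -enorm_seq_row// sqrtr_sqr ger0_norm ?enorm_ge0. Qed.

Lemma enormZ (a : R) x : enorm (a *: x) = `|a| * enorm x.
Proof.
rewrite /enorm (eq_bigr (fun i => a ^+ 2 * x 0 i ^+ 2)); last by move=> i _; rewrite mxE exprMn.
by rewrite -mulr_sumr sqrtrM ?sqr_ge0// sqrtr_sqr.
Qed.

Lemma enorm_sub_sqr (a : R) x (s : seq R) : size s = d ->
  enorm (x - a *: seq_row s) ^+ 2 = enorm x ^+ 2 + a ^+ 2 * sqs s - 2 * a * sdot (row_seq x) s.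
Proof.
move=> ss; rewrite !enorm_sqr sqsE ss sdotE ?size_row_seq ?ss//.
rewrite !mulr_sumr -big_split/= -sumrB; apply: eq_bigr => i _.
by rewrite !mxE nth_row_seq; ring.
Qed.

Definition axis_pt (r : R) : 'rV[R]_d := r *: delta_mx 0 0.

Lemma enorm_axis_pt r : 0 <= r -> enorm (axis_pt r) = r.
Proof.
move=> r0; rewrite enormZ ger0_norm// /enorm big_ord_recl !mxE !eqxx/= big1; last first.
  by move=> i _; rewrite !mxE/= expr0n.
by rewrite addr0 expr1n sqrtr1 mulr1.
Qed.

(* A radial function is encoded by its profile as a function of |z|^2. *)
Definition profile (f : 'rV[R]_d -> R) (w : R) : R := f (axis_pt (Num.sqrt w)).

Lemma profileE f z : radial f -> f z = profile f (enorm z ^+ 2).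
Proof.
move=> rf; apply: rf.
by rewrite sqrtr_sqr ger0_norm ?enorm_ge0// enorm_axis_pt// enorm_ge0.
Qed.

Lemma borel_preimage (g : R -> 'rV[R]_d) (A : set 'rV[R]_d) : continuous g ->
  (<<s @open 'rV[R]_d >>) A -> measurable (g @^-1` A).
Proof.
move=> cg; apply: (@smallest_sub _ _ _ [set A | measurable (g @^-1` A)]).
  split => /=.
  - by rewrite preimage_set0.
  - by move=> B mB; rewrite setTD preimage_setC; exact: measurableC.
  - by move=> F mF; rewrite preimage_bigcup; exact: bigcupT_measurable.
move=> U oU /=; apply: open_measurable; apply: open_comp => // x _; exact: cg.
Qed.

Lemma measurable_profile f : borel_fun f -> measurable_fun setT (profile f).
Proof.
move=> bf; apply: (measurability _ (RGenOpens.measurableE R)) => _ [_ [a [b ->] <-]].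
rewrite setTI; apply: (@borel_preimage (fun w => axis_pt (Num.sqrt w)) (f @^-1` `]a, b[)).
  move=> w; apply: (@continuous_comp _ _ _ (fun w => Num.sqrt w) axis_pt).
    exact: sqrt_continuous.
  exact: scalel_continuous.
by apply: bf; exact: itv_open.
Qed.

Lemma continuous_enorm_sqr : continuous (fun z : 'rV[R]_d => enorm z ^+ 2).
Proof.
rewrite (_ : (fun z => _) = (fun z : 'rV[R]_d => \sum_(i < d) z 0 i ^+ 2)); last first.
  by apply/funext => z; rewrite enorm_sqr.
apply: continuous_big => [|i _ z]; first by move=> p; exact: add_continuous.
apply: (@continuous_comp _ _ _ (fun z : 'rV[R]_d => z 0 i) (fun a => a ^+ 2)); first exact: coord_continuous.
exact: exprn_continuous.
Qed.

Lemma borel_radial psi : measurable_fun setT psi -> borel_fun (fun z : 'rV[R]_d => psi (enorm z ^+ 2)).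
Proof.
move=> mpsi U oU.
have mU : measurable (psi @^-1` U).
  by rewrite -[X in measurable X]setTI; apply: mpsi => //; exact: open_measurable.
rewrite (_ : _ @^-1` U = (fun z : 'rV[R]_d => enorm z ^+ 2) @^-1` (psi @^-1` U))//.
have {mU} : (@RGenOpens.G R).-sigma.-measurable (psi @^-1` U).
  by rewrite -RGenOpens.measurableE.
move: (psi @^-1` U).
apply: (@smallest_sub _ _ _ [set A | <<s @open 'rV[R]_d >> (_ @^-1` A)]).
  split => /=.
  - by rewrite preimage_set0; exact: sigma_algebra0.
  - by move=> B mB; rewrite setTD preimage_setC -setTD; exact: sigma_algebraCD.
  - by move=> F mF; rewrite preimage_bigcup; exact: sigma_algebra_bigcup.
move=> _ [a [b ->]] /=; apply: sub_gen_smallest.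
by apply: open_comp => [z _|]; [exact: continuous_enorm_sqr|exact: itv_open].
Qed.

Lemma radial_profile psi : radial (fun z : 'rV[R]_d => psi (enorm z ^+ 2)).
Proof. by move=> x y ->. Qed.
End Profiles.

(** Measurability plays no part: the integral is by definition the difference of those of f^+ and
    f^-, each of which is at most the integral of |f|. *)
Lemma abse_integral_le d (T : measurableType d) (R : realType)
    (m : {measure set T -> \bar R}) (f : T -> \bar R) :
  (`| \int[m]_x f x | <= \int[m]_x `|f x|)%E.
Proof.
rewrite integralE.
have p0 : (0 <= \int[m]_x f^\+ x)%E by apply: integral_ge0.
have n0 : (0 <= \int[m]_x f^\- x)%E by apply: integral_ge0.
have pl : (\int[m]_x f^\+ x <= \int[m]_x `|f x|)%E.
  by apply: le_integral_nonmeas => // x; rewrite -/((abse \o f) x) fune_abse leeDl.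
have nl : (\int[m]_x f^\- x <= \int[m]_x `|f x|)%E.
  by apply: le_integral_nonmeas => // x; rewrite -/((abse \o f) x) fune_abse leeDr.
have c0 : (0 <= \int[m]_x `|f x|)%E by apply: integral_ge0.
move: p0 n0 pl nl c0.
move: (integral m _ f^\+)%E (integral m _ f^\-)%E (\int[m]_x `|f x|)%E.
move=> [a| |] [b| |] [c| |] //=; rewrite ?leey// !lee_fin => a0 b0 ac bc _.
by rewrite ler_norml; apply/andP; split; lra.
Qed.

(** * Spherical means of radial functions as integrals over an angle variable *)

Section SphericalMeans.
Variables (R : realType) (n : nat).
Local Notation d := n.+2.
Implicit Types (x y z : 'rV[R]_d) (psi : R -> R).
Local Open Scope ereal_scope.

Lemma abse_iint_le k (F : seq R -> \bar R) : `|iint k F| <= iint k (fun s => `|F s|).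
Proof.
elim: k F => [|k IH] F //=.
apply: (le_trans (abse_integral_le _ _)).
by apply: le_integral_nonmeas => // x; exact: IH.
Qed.

Lemma eq_iint k (F G : seq R -> \bar R) : (forall s, size s = k -> F s = G s) -> iint k F = iint k G.
Proof.
elim: k F G => [|k IH] F G FG /=; first exact: FG.
by apply: eq_integral => x _; apply: IH => s ss; apply: FG; rewrite /= ss.
Qed.

Lemma integ_ge0 (g : 'rV[R]_d -> \bar R) : (forall x, 0 <= g x) -> 0 <= integ g.
Proof. by move=> g0; apply: iint_ge0. Qed.

Lemma le_integ (g h : 'rV[R]_d -> \bar R) : (forall x, 0 <= g x) -> (forall x, g x <= h x) ->
  integ g <= integ h.
Proof. by move=> g0 gh; apply: le_iint. Qed.

Lemma integ_radial : exists2 k : R, (0 < k)%R & forall h : R -> \bar R,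
  measurable_fun setT h -> (forall w, 0 <= h w) ->
  integ (fun x : 'rV[R]_d => h (enorm x ^+ 2)%R) = k%:E * \int[mu]_w (h w * (pw (d%:R / 2 - 1) w)%:E).
Proof.
have [k k0 H] := iint_sqE R n.+1; exists k; [by []|move=> h mh h0].
rewrite -H; [|by []|by []]; apply: eq_iint => s ss.
by rewrite -/(seq_row n s) enorm_seq_row.
Qed.

Definition ball_vol : \bar R := vol [set y : 'rV[R]_d | (enorm y <= 1)%R].

Lemma ball_vol_fin : (0 < fine ball_vol)%R.
Proof.
have [k k0 H] := integ_radial.
have E : ball_vol = k%:E * pint (d%:R / 2).
  rewrite /ball_vol /vol (_ : (fun x => _) = (fun x : 'rV[R]_d => (fun w => ((w <= 1)%R%:R)%:E) (enorm x ^+ 2)%R)).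
    rewrite (H (fun w => ((w <= 1)%R%:R)%:E)); [|side ..]; congr (_ * _).
    apply: (@eq_integral_but _ _ _ 1%R); [side ..|move=> w w1].
    by rewrite [in RHS]lt_neqAle w1.
  apply/funext => x; rewrite indicE mem_setE /=; congr (_%:R%:E).
  by rewrite expr_le1// enorm_ge0.
have h0 : (0 < d%:R / 2 :> R)%R by [].
by rewrite E fineM// ?pint_fin// mulr_gt0// -lte_fin fineK ?pint_fin// pint_gt0.
Qed.

Lemma sph_avg_abse t (f : 'rV[R]_d -> R) x :
  `|sph_avg t f x| <= sph_avg t (fun z => `|f z|%R) x.
Proof.
rewrite /sph_avg /sphere_int abseM.
have v0 : (0 <= (fine ball_vol)^-1)%R by rewrite invr_ge0 ltW// ball_vol_fin.
rewrite -/ball_vol gee0_abs ?lee_fin//; apply: lee_wpmul2l; first by rewrite lee_fin.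
apply: (le_trans (abse_iint_le _ _)); apply: le_iint => s; first exact: abse_ge0.
by case: ifPn => // _; rewrite abse0.
Qed.

(* Up to a constant, the spherical mean over radius t at |x| = r of z |-> psi (|z|^2);
   v is the cosine of the angle between x and the direction of integration. *)
Definition sphA psi (r t : R) : \bar R :=
  \int[mu]_v (psi (r ^+ 2 + t ^+ 2 - 2 * t * r * v) * pw (n.+1%:R / 2 - 1) (1 - v ^+ 2))%:E.

Lemma sph_avg_radial : exists2 c : R, (0 < c)%R & forall psi, measurable_fun setT psi ->
  (forall w, 0 <= psi w)%R -> forall t x,
  sph_avg t (fun z : 'rV[R]_d => psi (enorm z ^+ 2)%R) x = c%:E * sphA psi (enorm x) t.
Proof.
have [k k0 H] := iint_sphere R n.
have h0 : (0 < d%:R / 2 :> R)%R by [].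
exists ((fine ball_vol)^-1 * (k * fine (pint (d%:R / 2 : R))))%R.
  by rewrite !mulr_gt0 ?invr_gt0 ?ball_vol_fin// -lte_fin fineK ?pint_fin// pint_gt0.
move=> psi mpsi psi0 t x.
rewrite /sph_avg /sphere_int EFinM -muleA; congr (_ * _).
(* p stands for (x.y, |y|^2), and [p.1 * pw (- 2^-1) p.2] is the product of x with the unit vector
   y/|y|. Since [sphere_int] integrates over the solid ball, the radial variable contributes the
   factor pint (d/2). *)
pose G (p : R * R) : \bar R := (if ((0 < p.2) && (p.2 <= 1))%R then
  psi (enorm x ^+ 2 + t ^+ 2 - 2 * t * (p.1 * pw (- 2^-1) p.2)) else 0)%:E.
have mG : measurable_fun setT G by rewrite /G; meas.
have G0 p : 0 <= G p by rewrite /G; case: ifPn => _; pos.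
transitivity (iint n.+2 (fun s => G (sdot (row_seq x) s, sqs s))).
  apply: eq_iint => s ss; rewrite -/(seq_row n s) enorm_seq_rowE// sqrtr_gt0 /G/=.
  have [m0|m0] := ltrP 0%R (sqs s) => //=.
  rewrite -[X in (_ <= X)%R]sqrtr1 ler_sqrt//; case: ifPn => // _.
  rewrite scalerA enorm_sub_sqr// pwE// powRN powR12_sqrt ?(ltW m0)//.
  have q0 : Num.sqrt (sqs s) != 0%R by rewrite gt_eqF// sqrtr_gt0.
  congr (psi _)%:E.
  have -> : ((t / Num.sqrt (sqs s)) ^+ 2 * sqs s = t ^+ 2)%R.
    by rewrite expr_div_n sqr_sqrtr ?(ltW m0)// divfK// gt_eqF.
  by field.
rewrite (H _ (enorm x) G); [|by rewrite size_row_seq|by rewrite enorm_ge0|by rewrite enorm_row_seq|by []|by []].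
rewrite EFinM -muleA; congr (_ * _).
rewrite fineK ?pint_fin// muleC /pint -ge0_integralZl/=; [|by []|by meas|by pos|by rewrite /sphA; pos; rewrite mulr_ge0// pw_ge0].
(* The ball in [sphere_int] is closed while [pint] stops before 1, so the integrands may differ at m
   = 1. *)
apply: (@eq_integral_but _ _ _ 1%R).
- apply: emeasurable_funM; first by meas.
  apply: (@measurable_inner _ _ R (fun p : R * R => G ((enorm x * (Num.sqrt p.1 * p.2))%R, p.1) * (pw (n.+1%:R / 2 - 1) (1 - p.2 ^+ 2))%:E)); first by meas.
  by move=> ?; pos.
- by meas.
- by move=> ?; pos.
- by move=> ?; rewrite /sphA; pos.
move=> m m1.
have [m0|m0] := lerP m 0; first by rewrite !pw_le0// !mule0 mul0e.
rewrite muleC (_ : d%:R / 2 - 1 = n.+1%:R / 2 - 2^-1 :> R)%R; last by rewrite -(natr1 n.+1); lra.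
rewrite muleA; congr (_ * _).
case: (ltP m 1%R) => m1'; last first.
  rewrite mule0 integral0_eq// => v _; rewrite /G/= m0 leNgt lt_neqAle eq_sym m1 m1'/=.
  by rewrite mul0e.
rewrite mule1; apply: eq_integral => v _; rewrite /G/= m0 (ltW m1')/= -EFinM.
congr (psi (_ - _) * _)%:E.
rewrite (pwE _ m0) powRN powR12_sqrt ?(ltW m0)//.
have q0 : Num.sqrt m != 0%R by rewrite gt_eqF// sqrtr_gt0.
by field.
Qed.

End SphericalMeans.

(** * The pointwise bound by Young's inequality *)

Section WeakYoung.
Variables (R : realType) (n : nat).
Local Notation d := n.+2.
Implicit Types (psi h : R -> R).
Local Open Scope ereal_scope.

Let e : R := (d%:R / 2 - 1)%R.
Let gam : R := (n.+1%:R / 2 - 1)%R.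

Lemma young_weak (a b p q : R) : (0 <= a)%R -> (0 <= b)%R -> (1 < p)%R -> (1 < q)%R ->
  (p^-1 + q^-1 = 1)%R -> (a * b <= a `^ p + b `^ q)%R.
Proof.
move=> a0 b0 p1 q1 pq.
have H := @conjugate_powR R a b p q a0 b0 (lt_trans ltr01 p1) (lt_trans ltr01 q1) pq.
apply: (le_trans H); apply: lerD.
  by rewrite ler_pdivrMr ?(lt_trans ltr01 p1)// ler_peMr ?powR_ge0 ?ltW.
by rewrite ler_pdivrMr ?(lt_trans ltr01 q1)// ler_peMr ?powR_ge0 ?ltW.
Qed.

(** The exponent d/2 - 1 is that of the density of |z|^2 on R^d. At w = r^2 + t^2 - 2trv one has
    2tr(1 - v) = w - (r - t)^2 <= w, so the weight is absorbed by that density. [pw 0 (1 + v)] is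
    the indicator of v > -1. *)
Definition sphX h (r t : R) : \bar R :=
  \int[mu]_v (h (r ^+ 2 + t ^+ 2 - 2 * t * r * v) * (pw (d%:R / 2 - 1) (1 - v) * pw 0 (1 + v)))%:E.

Lemma sphX_ge0 h r t : (forall w, 0 <= h w)%R -> 0 <= sphX h r t.
Proof. by move=> h0; rewrite /sphX; pos. Qed.

(* Young's inequality with weights: (1 - v^2)^gam is split so that the conjugate
   factor is a beta integral, convergent exactly when p > d/(d-1). *)
Lemma sphA_weak (p : R) : (d%:R < p * n.+1%:R)%R ->
  exists2 C : R, (0 < C)%R & forall psi, measurable_fun setT psi -> (forall w, 0 <= psi w)%R ->
  forall r t l : R, (0 < l)%R -> l%:E <= sphA n psi r t ->
  (l `^ p)%:E <= C%:E * sphX (fun w => psi w `^ p)%R r t.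
Proof.
move=> hp.
have D1 : (1 <= n.+1%:R :> R)%R by rewrite ler1n.
have dE : (d%:R = n.+1%:R + 1 :> R)%R by rewrite natr1.
have p1 : (1 < p)%R.
  rewrite ltNge; apply/negP => p1.
  have : (p * n.+1%:R <= n.+1%:R)%R by rewrite ger_pMl// ltr0n.
  by lra.
have pm0 : (0 < p - 1)%R by lra.
pose q := (p / (p - 1))%R.
have q1 : (1 < q)%R by rewrite /q ltr_pdivlMr// mul1r; lra.
have pq : (p^-1 + q^-1 = 1)%R.
  by rewrite /q invf_div; field; lra.
have p0 : (0 < p)%R by lra.
have q0 : (0 < q)%R by lra.
pose a1 := ((gam - e / p) * q)%R.
pose b1 := (gam * q)%R.
have a1E : a1 = ((gam * p - e) / (p - 1))%R.
  by rewrite /a1 /q; field; apply/andP; split; lra.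
have b1E : b1 = (gam * p / (p - 1))%R by rewrite /b1 /q mulrA.
(* Multiplied out, this says p (gam + 1) > e + 1, that is p (d-1)/2 > d/2. *)
have a1g : (-1 < a1)%R.
  rewrite a1E ltr_pdivlMr//; rewrite /gam /e dE; nra.
have b1g : (-1 < b1)%R.
  rewrite b1E ltr_pdivlMr//; rewrite /gam; nra.
pose K := \int[mu]_v (pw a1 (1 - v) * pw b1 (1 + v))%:E.
have Klt : K < +oo := integral_beta_lty a1g b1g.
have K0 : 0 <= K by rewrite /K; pos.
have Kf : K \is a fin_num by rewrite ge0_fin_numE.
pose k := fine K.
have k0 : (0 <= k)%R by rewrite fine_ge0.
(* With eps^q = 2(k + 1) the conjugate term is at most l/2, so it can be absorbed into the level
   l. *)
pose eps := ((2 * (k + 1)) `^ (q^-1))%R.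
have eps0 : (0 < eps)%R by rewrite powR_gt0//; lra.
have epsq : (eps `^ q = 2 * (k + 1))%R.
  by rewrite /eps -powRrM mulVf ?gt_eqF// powRr1//; lra.
exists (2 * eps `^ p)%R; first by rewrite mulr_gt0// powR_gt0.
move=> psi mpsi psi0 r t l l0 hl.
set X := sphX _ r t.
have X0 : 0 <= X by rewrite /X sphX_ge0// => w; exact: powR_ge0.
pose c1 := (l `^ (1 - p) * eps `^ p)%R.
have c10 : (0 <= c1)%R by rewrite /c1 mulr_ge0 ?powR_ge0.
pose c2 := (l / eps `^ q)%R.
have c20 : (0 <= c2)%R by rewrite /c2; apply: mulr_ge0; [exact: ltW|rewrite invr_ge0 powR_ge0].
have Y : sphA n psi r t <= c1%:E * X + c2%:E * K.
  rewrite /X /sphX /K.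
  rewrite -!ge0_integralZl/=; [|side ..].
  rewrite -ge0_integralD/=; [|side ..].
  rewrite /sphA; apply: le_integral_nonmeas => v; first by pos.
  rewrite -!EFinM -EFinD lee_fin pw_1Bsqr -/gam -/e.
  set P := psi _; have P0 : (0 <= P)%R by rewrite /P.
  have [v1|v1] := lerP (1 - v) 0.
    by rewrite (pw_le0 _ v1) !(mul0r, mulr0); pos.
  have [v2|v2] := lerP (1 + v) 0.
    by rewrite (pw_le0 _ v2) !(mul0r, mulr0); pos.
  rewrite (pw0 v2) mulr1.
  (* Dividing P by l makes Young's inequality homogeneous in the level: the conjugate term scales
     like l, and the main one like l^(1-p) P^p. *)
  pose a := (eps * (P / l) * pw (e / p) (1 - v))%R.
  pose b := (eps^-1 * (pw (gam - e / p) (1 - v) * pw gam (1 + v)))%R.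
  have a0 : (0 <= a)%R by rewrite /a; pos.
  have b0 : (0 <= b)%R by rewrite /b; pos.
  have abE : (l * (a * b) = P * (pw gam (1 - v) * pw gam (1 + v)))%R.
    rewrite /a /b.
    have -> : pw gam (1 - v) = (pw (e / p) (1 - v) * pw (gam - e / p) (1 - v))%R.
      by rewrite -pwD; congr pw; lra.
    by field; apply/andP; split; rewrite gt_eqF.
  have apE : (l * a `^ p = c1 * (P `^ p * pw e (1 - v)))%R.
    rewrite /a /c1.
    rewrite powRM; [|by pos|by pos].
    rewrite powRM; [|by pos|by pos].
    rewrite powRM; [|by pos|by pos].
    rewrite pw_powR ?gt_eqF// divfK ?gt_eqF//.
    have -> : (l^-1 `^ p = l `^ (- p))%R.
      by rewrite -(powR_inv1 (ltW l0)) -powRrM mulN1r.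
    have -> : (l `^ (1 - p) = l * l `^ (- p))%R.
      by rewrite powRD ?(gt_eqF l0) ?implybT// powRr1// ltW.
    by ring.
  have bqE : (l * b `^ q = c2 * (pw a1 (1 - v) * pw b1 (1 + v)))%R.
    rewrite /b /c2.
    rewrite powRM; [|by pos|by pos].
    rewrite powRM; [|by pos|by pos].
    rewrite !pw_powR ?gt_eqF//.
    have -> : (eps^-1 `^ q = (eps `^ q)^-1)%R.
      by rewrite -(powR_inv1 (ltW eps0)) -powRrM mulN1r powRN.
    by rewrite /a1 /b1; ring.
  rewrite -abE -apE -bqE -mulrDr ler_pM2l//.
  exact: young_weak.
have KE : c2%:E * K = (l * k / (2 * (k + 1)))%:E.
  by rewrite -(fineK Kf) -EFinM /c2 epsq mulrAC.
have {Y} : (l / 2)%:E <= c1%:E * X.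
  have : l%:E <= c1%:E * X + (l * k / (2 * (k + 1)))%:E by rewrite -KE; exact: (le_trans hl Y).
  move: (c1%:E * X) => [x| |]//; last by move=> _; rewrite leey.
  rewrite -EFinD !lee_fin => H.
  have : (l * k / (2 * (k + 1)) <= l / 2)%R.
    rewrite ler_pdivrMr; last lra.
    by nra.
  by lra.
move=> H.
have -> : (l `^ p)%:E = (2 * l `^ (p - 1))%:E * (l / 2)%:E :> \bar R.
  rewrite -EFinM; congr (_%:E).
  by rewrite -(mulr_powRB1 (ltW l0) p0); lra.
apply: (@le_trans _ _ ((2 * l `^ (p - 1))%:E * (c1%:E * X))).
  by apply: lee_wpmul2l => //; rewrite lee_fin; pos.
rewrite muleA -EFinM /c1.
have -> : (2 * l `^ (p - 1) * (l `^ (1 - p) * eps `^ p) = 2 * eps `^ p)%R; last by [].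
have -> : (1 - p = - (p - 1))%R by lra.
rewrite powRN -mulrA; congr (2 * _)%R.
by rewrite mulrA mulfV ?mul1r// gt_eqF// powR_gt0.
Qed.

Lemma sphX_subst h (r t : R) : measurable_fun setT h -> (forall w, 0 <= h w)%R ->
  (0 < r)%R -> (0 < t)%R ->
  sphX h r t = ((2 * t * r)^-1)%:E *
   \int[mu]_w (h w * (pw e ((w - (r - t) ^+ 2) / (2 * t * r)) * pw 0 (((r + t) ^+ 2 - w) / (2 * t * r))))%:E.
Proof.
move=> mh h0 r0 t0.
have tr0 : (0 < 2 * t * r)%R by rewrite !mulr_gt0.
rewrite -(@ge0_integral_affine _ _ _ (r ^+ 2 + t ^+ 2)%R tr0); [|side ..].
rewrite -[RHS]ge0_integral_opp; [|side ..].
rewrite /sphX; apply: eq_integral => v _; congr (h _ * (pw _ _ * pw _ _))%:E.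
- by ring.
- by field; rewrite !gt_eqF.
- by field; rewrite !gt_eqF.
Qed.
End WeakYoung.

(** * The pointwise bound near the origin, at distance, and in the tail *)

Section Localization.
Variables (R : realType) (n : nat).
Local Notation d := n.+2.
Implicit Types (psi h : R -> R).
Local Open Scope ereal_scope.

Local Notation e := (d%:R / 2 - 1 : R)%R.

Lemma e_ge0 : (0 <= e)%R.
Proof. by have : (0 <= n%:R :> R)%R by []; rewrite -(natr1 n.+1) -(natr1 n); lra. Qed.

Definition wnorm h : \bar R := \int[mu]_w (h w * pw (d%:R / 2 - 1) w)%:E.
(** The range 1/4 < w < 9 contains every w between (r - t)^2 and (r + t)^2 with r < 1/2 and 1 <= t
    <= 2. *)
Definition annulus_int h : \bar R := \int[mu]_w (h w * ((4^-1 < w) && (w < 9))%R%:R)%:E.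

Lemma pw_0_le1 (x : R) : (pw 0 x <= 1)%R.
Proof. by rewrite /pw powRr0; case: ifP. Qed.

(** Here 2tr >= 1, so the Jacobian 1/(2tr) is at most 1 and the weight at most that of [wnorm]. *)
Lemma sphX_far h (r t : R) : measurable_fun setT h -> (forall w, 0 <= h w)%R ->
  (2^-1 <= r)%R -> (1 <= t)%R -> sphX n h r t <= wnorm h.
Proof.
move=> mh h0 r2 t1; have r0 : (0 < r)%R by lra.
have t0 : (0 < t)%R by lra.
have tr1 : (1 <= 2 * t * r)%R by nra.
have tr0 : (0 < 2 * t * r)%R by lra.
rewrite (sphX_subst _ mh h0 r0 t0).
apply: (@le_trans _ _ (1%:E * wnorm h)); last by rewrite mul1e.
apply: lee_pmul; [by rewrite lee_fin invr_ge0 ltW|by pos|by rewrite lee_fin invf_le1|].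
apply: le_integral_nonmeas => w; first by pos.
rewrite lee_fin ler_wpM2l// -[X in (_ <= X)%R]mulr1 ler_pM ?pw_ge0 ?pw_0_le1//.
have [w0|w0] := lerP w 0.
  rewrite (pw_le0 _ w0) pw_le0// pmulr_lle0 ?invr_gt0//.
  by rewrite subr_le0 (le_trans w0)// sqr_ge0.
apply: ler_pw; first exact: e_ge0.
rewrite ler_pdivrMr//; have := sqr_ge0 (r - t); nra.
Qed.

(** The Jacobian 1/(2tr) is at most 1/r, and the weight at most 2^e because 1 - v < 2 on the range
    of integration. *)
Lemma sphX_near h (r t : R) : measurable_fun setT h -> (forall w, 0 <= h w)%R ->
  (0 < r < 2^-1)%R -> (1 <= t <= 2)%R ->
  sphX n h r t <= (pw e 2 / r)%:E * annulus_int h.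
Proof.
move=> mh h0 /andP[r0 r2] /andP[t1 t2].
have t0 : (0 < t)%R by lra.
have tr0 : (0 < 2 * t * r)%R by nra.
rewrite (sphX_subst _ mh h0 r0 t0).
have -> : (pw e 2 / r)%:E * annulus_int h = (r^-1)%:E * \int[mu]_w ((pw e 2)%:E * (h w * ((4^-1 < w) && (w < 9))%R%:R)%:E).
  by rewrite ge0_integralZl//=; [rewrite muleA -EFinM (mulrC r^-1%R)|side ..].
apply: lee_pmul; [by rewrite lee_fin invr_ge0 ltW|by pos| |].
  by rewrite lee_fin lef_pV2 ?posrE//; nra.
apply: le_integral_nonmeas => w; first by pos.
rewrite -EFinM lee_fin [leRHS]mulrCA ler_wpM2l//.
have [w1|w1] := lerP (w - (r - t) ^+ 2) 0.
  have z : ((w - (r - t) ^+ 2) / (2 * t * r) <= 0)%R by rewrite pmulr_lle0 ?invr_gt0.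
  by rewrite (pw_le0 _ z) mul0r; pos.
have [w2|w2] := lerP ((r + t) ^+ 2 - w) 0.
  have z : (((r + t) ^+ 2 - w) / (2 * t * r) <= 0)%R by rewrite pmulr_lle0 ?invr_gt0.
  by rewrite (pw_le0 _ z) mulr0; pos.
have -> : ((4^-1 < w) && (w < 9))%R by apply/andP; split; nra.
rewrite ler_pM ?pw_ge0 ?pw_0_le1//.
apply: ler_pw; first exact: e_ge0.
rewrite ler_pdivrMr//; nra.
Qed.

Lemma annulus_int_le h : measurable_fun setT h -> (forall w, 0 <= h w)%R ->
  annulus_int h <= (pw e 4)%:E * wnorm h.
Proof.
move=> mh h0; rewrite /wnorm -ge0_integralZl/=; [|side ..].
apply: le_integral_nonmeas => w; first by pos.
rewrite -EFinM lee_fin.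
case: (boolP (_ && _)) => [/andP[w1 w2]|_]; last by rewrite mulr0; pos.
rewrite mulrCA ler_wpM2l//.
rewrite -pwM//; apply: (@le_trans _ _ (pw e 1)); first by rewrite pwE// powR1.
by apply: ler_pw; [exact: e_ge0|lra].
Qed.

Definition shell_int h (r : R) : \bar R :=
  \int[mu]_w (h w * (((r - 2) ^+ 2 < w) && (w < (r + 2) ^+ 2))%R%:R)%:E.

Lemma sphX_tail h (r t : R) : measurable_fun setT h -> (forall w, 0 <= h w)%R ->
  (4 <= r)%R -> (1 <= t <= 2)%R ->
  sphX n h r t <= (pw e 2 / r)%:E * shell_int h r.
Proof.
move=> mh h0 r4 /andP[t1 t2].
have r0 : (0 < r)%R by lra.
have t0 : (0 < t)%R by lra.
have tr0 : (0 < 2 * t * r)%R by nra.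
rewrite (sphX_subst _ mh h0 r0 t0).
have -> : (pw e 2 / r)%:E * shell_int h r = (r^-1)%:E * \int[mu]_w ((pw e 2)%:E * (h w * (((r - 2) ^+ 2 < w) && (w < (r + 2) ^+ 2))%R%:R)%:E).
  by rewrite ge0_integralZl//=; [rewrite muleA -EFinM (mulrC r^-1%R)|side ..].
apply: lee_pmul; [by rewrite lee_fin invr_ge0 ltW|by pos| |].
  by rewrite lee_fin lef_pV2 ?posrE//; nra.
apply: le_integral_nonmeas => w; first by pos.
rewrite -EFinM lee_fin [leRHS]mulrCA ler_wpM2l//.
have [w1|w1] := lerP (w - (r - t) ^+ 2) 0.
  have z : ((w - (r - t) ^+ 2) / (2 * t * r) <= 0)%R by rewrite pmulr_lle0 ?invr_gt0.
  by rewrite (pw_le0 _ z) mul0r; pos.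
have [w2|w2] := lerP ((r + t) ^+ 2 - w) 0.
  have z : (((r + t) ^+ 2 - w) / (2 * t * r) <= 0)%R by rewrite pmulr_lle0 ?invr_gt0.
  by rewrite (pw_le0 _ z) mulr0; pos.
have -> : (((r - 2) ^+ 2 < w) && (w < (r + 2) ^+ 2))%R by apply/andP; split; nra.
rewrite ler_pM ?pw_ge0 ?pw_0_le1//.
apply: ler_pw; first exact: e_ge0.
rewrite ler_pdivrMr//; nra.
Qed.

Lemma sphX_le h (r t : R) : measurable_fun setT h -> (forall w, 0 <= h w)%R ->
  (0 < r)%R -> (1 <= t <= 2)%R ->
  sphX n h r t <= ((1 + pw e 8) * (1 + r^-1))%:E * wnorm h.
Proof.
move=> mh h0 r0 t12.
have w0 : 0 <= wnorm h by rewrite /wnorm; pos.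
have p8 : (0 <= pw e 8 :> R)%R by exact: pw_ge0.
have ri : (0 <= r^-1 :> R)%R by rewrite invr_ge0 ltW.
have [r2|r2] := lerP (2^-1)%R r.
  apply: (le_trans (sphX_far mh h0 r2 _)); first by case/andP: t12.
  by rewrite -[leLHS]mul1e lee_wpmul2r// lee_fin; nra.
apply: (le_trans (sphX_near mh h0 _ t12)); first by rewrite r0.
apply: (@le_trans _ _ ((pw e 2 / r)%:E * ((pw e 4)%:E * wnorm h))).
  by apply: lee_wpmul2l; [by pos|exact: annulus_int_le].
rewrite muleA -EFinM lee_wpmul2r// lee_fin mulrAC -pwM//.
have -> : (2 * 4 = 8 :> R)%R by lra.
nra.
Qed.

End Localization.

Lemma eq_ler (R : realType) (x y : R) : x = y -> x <= y.
Proof. by move=> ->. Qed.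

(** * Integrable majorants: Fubini on shells, and level sets near the origin *)

Section NearOrigin.
Variables (R : realType) (n : nat).
Local Notation d := n.+2.
Implicit Types (psi h : R -> R).
Local Open Scope ereal_scope.
Local Notation e := (d%:R / 2 - 1 : R)%R.

Lemma sphA_cut psi (r t x : R) : measurable_fun setT psi -> (forall w, 0 <= psi w)%R -> (0 <= x)%R ->
  sphA n psi r t <= (x * fine (sconst R n))%:E + sphA n (fun w => psi w * (x < psi w)%R%:R)%R r t.
Proof.
move=> mpsi psi0 x0.
rewrite EFinM fineK ?sconst_fin// /sconst -ge0_integralZl/=; [|side ..].
rewrite /sphA -ge0_integralD/=; [|by []|by pos|by meas|by pos|by meas].
apply: le_integral_nonmeas => v; first by pos.
rewrite -EFinM -EFinD lee_fin -mulrDl ler_wpM2r ?pw_ge0//.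
by case: ltP => xp; rewrite ?mulr1 ?mulr0 ?addr0// lerDr.
Qed.

(** After Fubini, for fixed w, r runs through an interval of length 4 about sqrt w. As r >= 4, also
    r <= 2 sqrt w, hence r^(-1) (1 + r^(n+1)) <= 2 r^n <= 2^(n+1) w^(n/2), where n/2 is the exponent
    in [wnorm]. *)
Lemma tail_bound h : measurable_fun setT h -> (forall w, 0 <= h w)%R ->
  \int[mu]_r (((4 <= r)%R%:R * (pw (-1) r * (1 + r ^+ n.+1)))%:E * shell_int h r)
  <= (2 ^+ n.+1 * 4)%:E * wnorm n h.
Proof.
move=> mh h0.
pose F (p : R * R) : \bar R := ((4 <= p.1)%R%:R * (pw (-1) p.1 * (1 + `|p.1| ^+ n.+1)) *
   (h p.2 * (((p.1 - 2) ^+ 2 < p.2) && (p.2 < (p.1 + 2) ^+ 2))%R%:R))%:E.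
have mF : measurable_fun setT F by rewrite /F; meas.
have F0 p : 0 <= F p by rewrite /F; pos.
rewrite (_ : \int[mu]_r _ = \int[mu]_r \int[mu]_w F (r, w)); last first.
  apply: eq_integral => r _.
  have [r4|r4] := lerP 4%R r; last first.
    rewrite mul0r mul0e integral0_eq// => w _; rewrite /F/= leNgt r4/=.
    by rewrite !mul0r.
  rewrite /shell_int -ge0_integralZl/=; [|by []|by meas|by pos|].
    apply: eq_integral => w _; rewrite -EFinM /F/= r4 ger0_norm//; lra.
  have r0 : (0 <= r)%R by lra.
  by pos.
rewrite (ge0_integral_swap mF F0) /wnorm -ge0_integralZl/=; [|side ..].
apply: le_integral_nonmeas => w; first by pos.
pose s := Num.sqrt w.
have s0 : (0 <= s)%R by rewrite sqrtr_ge0.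
rewrite -EFinM.
have -> : (2 ^+ n.+1 * 4 * (h w * pw e w) = (2 ^+ n.+1 * pw e w * h w) * (s + 2 - (s - 2)))%R by ring.
apply: integral_le_box; [lra|by pos|by pos|move=> r].
rewrite /F/= lee_fin.
have [r4|r4] := lerP 4%R r; last by rewrite !mul0r; pos.
case: (boolP (_ && (w < _)%R)) => [/andP[w1 w2]|_]; last by rewrite !mulr0; pos.
have r0 : (0 < r)%R by lra.
have w0 : (0 < w)%R by rewrite (le_lt_trans (sqr_ge0 _) w1).
have sE : (s ^+ 2 = w)%R by rewrite sqr_sqrtr// ltW.
have -> : ((s - 2 <= r) && (r <= s + 2))%R by apply/andP; split; nra.
have rs : (r <= 2 * s)%R by nra.
rewrite !mul1r mulr1 ler_wpM2r// ger0_norm ?(ltW r0)//.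
rewrite pwE// powR_inv1 ?(ltW r0)//.
have r1 : (1 <= r)%R by lra.
apply: (@le_trans _ _ (2 * r ^+ n)%R).
  rewrite mulrDr mulr1 exprS mulKf ?gt_eqF//.
  have : (r^-1 <= 1)%R by rewrite invf_le1.
  have : (1 <= r ^+ n)%R by rewrite exprn_ege1.
  by lra.
rewrite exprS -mulrA ler_wpM2l//.
have -> : (pw e w = s ^+ n)%R.
  rewrite pwE// /s -powR12_sqrt ?(ltW w0)// -powR_mulrn ?powR_ge0// -powRrM.
  by congr (powR _ _); rewrite -(natr1 n.+1) -(natr1 n); lra.
by rewrite -exprMn lerXn2r// nnegrE; lra.
Qed.

(* If l < sphA psi r t then, for every x < l / c2, the mean of the part of psi above
   level x is at least x, so the bound with exponent p1 gives r x^p1 <= C2 H(x).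
   Integrating p x^(p-1) over those x and then over r makes both integrals elementary. *)
Lemma near_bound (p p1 : R) : (d%:R < p1 * n.+1%:R)%R -> (p1 < p)%R ->
  exists2 C : R, (0 < C)%R & forall psi, measurable_fun setT psi -> (forall w, 0 <= psi w)%R ->
  exists2 Psi : R -> \bar R, measurable_fun setT Psi /\ (forall r, 0 <= Psi r) &
  (forall r t l : R, (0 < r < 2^-1)%R -> (1 <= t <= 2)%R -> (0 < l)%R ->
     l%:E < sphA n psi r t -> (l `^ p)%:E <= Psi r) /\
  \int[mu]_r (((0 < r)%R%:R)%:E * Psi r) <= C%:E * wnorm n (fun w => psi w `^ p)%R.
Proof.
move=> hp1 p1p.
have D1 : (1 <= n.+1%:R :> R)%R by rewrite ler1n.
have dE : (d%:R = n.+1%:R + 1 :> R)%R by rewrite natr1.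
have p10 : (0 < p1)%R.
  by rewrite ltNge; apply/negP => p1n; nra.
have p0 : (0 < p)%R by lra.
have pp1 : (0 < p - p1)%R by lra.
have [C1 C10 HC1] := sphA_weak hp1.
pose c1 : R := fine (sconst R n).
have c10 : (0 <= c1)%R by rewrite fine_ge0// ltW// sconst_gt0.
(* If x c2 < l, the part of psi below x contributes at most x c1 to the mean, which leaves at least
   x for the part above. *)
pose c2 := (c1 + 1)%R.
have c20 : (0 < c2)%R by rewrite /c2; lra.
pose C2 := (C1 * pw e 2)%R.
have C20 : (0 < C2)%R by rewrite /C2 mulr_gt0// pw_gt0.
have pint0 s : (0 < s)%R -> (0 < fine (pint s : \bar R))%R.
  by move=> s0; rewrite -lte_fin fineK ?pint_fin// pint_gt0.
(* Chosen so that C3 times the integral of x^(p-1) over 0 < x < l/c2 equals l^p. *)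
pose C3 := (c2 `^ p / fine (pint p))%R.
have C30 : (0 < C3)%R by rewrite /C3 mulr_gt0 ?powR_gt0// invr_gt0 pint0.
exists (C3 * (C2 * (fine (pint (p - p1)) * pw e 4)))%R.
  by rewrite mulr_gt0// mulr_gt0// mulr_gt0 ?pint0 ?pw_gt0.
move=> psi mpsi psi0.
pose cut (l w : R) := (psi w * (l < psi w)%R%:R)%R.
have cut0 l w : (0 <= cut l w)%R by rewrite /cut; pos.
have mcut l : measurable_fun setT (cut l) by rewrite /cut; meas.
pose H (l : R) := annulus_int (fun w => cut l w `^ p1)%R.
have H0 l : 0 <= H l by rewrite /H /annulus_int; pos.
have mH : measurable_fun setT H by rewrite /H /annulus_int /cut; side.
(* The condition on the level involves neither t nor the value of a mean, so one function of r
   majorizes all means at that radius. *)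
pose Psi (r : R) := C3%:E * \int[mu]_l ((pw (p - 1) l)%:E * (((r * pw p1 l)%:E <= C2%:E * H l)%E%:R)%:E).
have Psi0 r : 0 <= Psi r.
  by rewrite /Psi; pos.
have mb : measurable_fun setT (fun q : R * R => ((q.1 * pw p1 q.2)%:E <= C2%:E * H q.2)%E).
  apply: measurable_fun_lee; first by meas.
  by apply: emeasurable_funM; [meas|exact: (measurableT_comp mH)].
have mPsi : measurable_fun setT Psi by rewrite /Psi; meas; pos.
exists Psi; first by [].
split.
  move=> r t l /andP[r0 r2] t12 l0 lA.
  apply: (@le_trans _ _ (C3%:E * \int[mu]_x (((x < l / c2)%R%:R)%:E * (pw (p - 1) x)%:E))).
    rewrite integral_pw_lt//; last by rewrite divr_ge0// ltW.
    rewrite -(fineK (pint_fin p0)) -!EFinM lee_fin.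
    rewrite pwE ?divr_gt0// powRM ?(ltW l0)// ?invr_ge0 ?(ltW c20)//.
    rewrite -(powR_inv1 (ltW c20)) -powRrM mulN1r powRN /C3.
    have u0 : (c2 `^ p != 0)%R by rewrite gt_eqF// powR_gt0.
    have v0 : fine (pint p) != 0%R by rewrite gt_eqF// pint0.
    by apply: eq_ler; field; rewrite u0.
  apply: lee_wpmul2l; first by rewrite lee_fin ltW.
  apply: le_integral_nonmeas => x; first by pos.
  rewrite muleC; have [x0|x0] := lerP x 0; first by rewrite !pw_le0// !mul0e.
  apply: lee_wpmul2l; first by pos.
  rewrite lee_fin ler_nat; case: ltP => //= xl; rewrite lt0b.
  have lx : x%:E <= sphA n (cut x) r t.
    have S := sphA_cut r t mpsi psi0 (ltW x0).
    rewrite -/c1 -/(cut x) in S.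
    have : (x * c2)%:E <= (x * c1)%:E + sphA n (cut x) r t.
      apply: (le_trans _ S); apply: ltW; apply: le_lt_trans lA.
      by rewrite lee_fin -ler_pdivlMr// ltW.
    move: (sphA _ _ _ _) => [y| |]//; last by move=> _; rewrite leey.
    by rewrite -EFinD !lee_fin /c2; lra.
  have := HC1 _ (mcut x) (cut0 x) _ _ _ x0 lx.
  have mm : measurable_fun setT (fun w => cut x w `^ p1)%R by meas.
  have m0 w : (0 <= cut x w `^ p1)%R by exact: powR_ge0.
  have rr : (0 < r < 2^-1)%R by rewrite r0.
  have X1 := sphX_near n mm m0 rr t12.
  move=> X2.
  have := le_trans X2 (lee_wpmul2l (_ : 0 <= C1%:E) X1).
  rewrite lee_fin ltW// => /(_ isT) X3.
  rewrite (pwE _ x0) EFinM.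
  apply: (le_trans (lee_wpmul2l (_ : 0 <= r%:E) X3)); first by rewrite lee_fin ltW.
  rewrite -/(H x) !muleA -!EFinM /C2.
  have -> : (r * C1 * (pw e 2 / r) = C1 * pw e 2)%R by field; rewrite gt_eqF.
  by [].
(* For a fixed level the admissible r fill an interval starting at 0. Its length is finite although
   1/r is not integrable, which is the use of the weak form. *)
have inner l : (0 < l)%R ->
    \int[mu]_r ((0 < r)%R%:R * (((r * pw p1 l)%:E <= C2%:E * H l)%E%:R))%:E <= (C2 * pw (- p1) l)%:E * H l.
  move=> l0; have q0 : (0 < pw p1 l)%R by rewrite pw_gt0.
  have q1 : (0 < C2 * pw (- p1) l)%R by rewrite mulr_gt0// pw_gt0.
  move: (H l) (H0 l) => [y| |] y0; last by [].
    rewrite lee_fin in y0.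
    have bE : (C2 * pw (- p1) l * y = 1 * (C2 * pw (- p1) l * y - 0))%R by lra.
    rewrite -[leRHS]EFinM bE; apply: integral_le_box; [by pos|by []|by pos|move=> r].
    rewrite lee_fin mulr1; case: ltP => r0; last by rewrite mul0r; pos.
    case: (boolP (_ <= _)%E) => [rle|_]; last by rewrite mulr0; pos.
    suff -> : (r <= C2 * pw (- p1) l * y)%R by rewrite (ltW r0) mulr1.
    have -> : pw (- p1) l = (pw p1 l)^-1%R by rewrite !pwE// powRN.
    by rewrite mulrAC ler_pdivlMr// -lee_fin EFinM.
  by rewrite [leRHS]gt0_muley ?lte_fin// leey.
have mF : measurable_fun setT (fun q : R * R => ((0 < q.1)%R%:R%:E * ((pw (p - 1) q.2)%:E *
    (((q.1 * pw p1 q.2)%:E <= C2%:E * H q.2)%E%:R)%:E))) by meas.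
have stepA : \int[mu]_r (((0 < r)%R%:R)%:E * Psi r) <=
    C3%:E * (C2%:E * \int[mu]_l ((pw (p - p1 - 1) l)%:E * H l)).
  rewrite (_ : \int[mu]_r _ = C3%:E * \int[mu]_r \int[mu]_l (((0 < r)%R%:R)%:E * ((pw (p - 1) l)%:E * (((r * pw p1 l)%:E <= C2%:E * H l)%E%:R)%:E))); last first.
    apply: ge0_integralZl_ext; [side|by pos|by rewrite lee_fin ltW|move=> r].
    rewrite /Psi muleCA; congr (_ * _); apply/esym.
    by apply: ge0_integralZl_ext; [by meas|by pos|by pos|].
  apply: lee_wpmul2l; first by rewrite lee_fin ltW.
  rewrite (_ : C2%:E * _ = \int[mu]_l (C2%:E * ((pw (p - p1 - 1) l)%:E * H l))); last first.
    by apply/esym/ge0_integralZl_ext; [by meas|by pos|by rewrite lee_fin ltW|].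
  rewrite (_ : \int[mu]_r _ = \int[mu]_l \int[mu]_r (((0 < r)%R%:R)%:E * ((pw (p - 1) l)%:E * (((r * pw p1 l)%:E <= C2%:E * H l)%E%:R)%:E))); last first.
    by apply: (ge0_integral_swap mF); pos.
  apply: le_integral_nonmeas => l; first by pos.
  have [l0|l0] := lerP l 0.
    rewrite integral0_eq; first by pos.
    by move=> r _; rewrite (pw_le0 _ l0) mul0e mule0.
  rewrite (_ : \int[mu]_r _ = (pw (p - 1) l)%:E * \int[mu]_r ((0 < r)%R%:R * (((r * pw p1 l)%:E <= C2%:E * H l)%E%:R))%:E); last first.
    apply: ge0_integralZl_ext; [by meas|by pos|by pos|move=> r].
    by rewrite EFinM muleCA.
  apply: (le_trans (lee_wpmul2l _ (inner _ l0))); first by pos.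
  have -> : (p - p1 - 1 = p - 1 + (- p1))%R by lra.
  by rewrite (pwD (p - 1) (- p1)) !muleA -!EFinM mulrCA.
apply: (le_trans stepA); rewrite (EFinM C3) (EFinM C2) (EFinM (fine _)) -!muleA.
apply: lee_wpmul2l; first by rewrite lee_fin ltW.
apply: lee_wpmul2l; first by rewrite lee_fin ltW.
apply: (@le_trans _ _ ((fine (pint (p - p1)))%:E * annulus_int (fun w => psi w `^ p)%R)); last first.
  apply: lee_wpmul2l; first by rewrite lee_fin ltW// pint0.
  by apply: annulus_int_le => [|w]; [meas|exact: powR_ge0].
pose E (q : R * R) : \bar R := (pw (p - p1 - 1) q.1)%:E * ((cut q.1 q.2 `^ p1 * ((4^-1 < q.2) && (q.2 < 9))%R%:R)%:E).
have mE : measurable_fun setT E by rewrite /E /cut; meas.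
have E0 q : 0 <= E q by rewrite /E; pos.
rewrite (_ : \int[mu]_l _ = \int[mu]_l \int[mu]_w E (l, w)); last first.
  apply: eq_integral => l _; apply/esym/ge0_integralZl_ext; [by rewrite /cut; meas|by pos|by pos|by []].
rewrite (ge0_integral_swap mE E0).
rewrite (_ : _ * annulus_int _ = \int[mu]_w ((fine (pint (p - p1)))%:E * (psi w `^ p * ((4^-1 < w) && (w < 9))%R%:R)%:E)); last first.
  by apply/esym/ge0_integralZl_ext; [by meas|by pos|by rewrite lee_fin ltW// pint0|].
apply: le_integral_nonmeas => w; first by pos.
(* Only levels l < psi w see the point w. The integral of l^(p-p1-1) over them converges at 0
   because p1 < p, and it restores the missing factor psi^(p-p1). *)
rewrite (_ : \int[mu]_l _ = (psi w `^ p1 * ((4^-1 < w) && (w < 9))%R%:R)%:E * \int[mu]_l (((l < psi w)%R%:R)%:E * (pw (p - p1 - 1) l)%:E)); last first.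
  apply: ge0_integralZl_ext; [by meas|by pos|by pos|move=> l].
  rewrite /E/= -!EFinM; congr (_%:E).
  rewrite /cut; case: ltP => _; first by rewrite mulr1 mul1r mulrC.
  by rewrite mulr0 powR0 ?gt_eqF// !(mul0r, mulr0).
rewrite integral_pw_lt// -(fineK (pint_fin pp1)) -!EFinM lee_fin fineK ?pint_fin//.
have -> : (psi w `^ p = psi w `^ p1 * pw (p - p1) (psi w))%R.
  have := psi0 w; rewrite le_eqVlt => /predU1P[<-|pw0].
    by rewrite powR0 ?gt_eqF// powR0 ?gt_eqF// mul0r.
  by rewrite -pwE// -pwE// -pwD; congr pw; lra.
by apply: eq_ler; ring.
Qed.
End NearOrigin.

(** * One majorant for all radii *)

Section MaximalBound.
Variables (R : realType) (n : nat).
Local Notation d := n.+2.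
Implicit Types (psi h : R -> R).
Local Open Scope ereal_scope.
Local Notation e := (d%:R / 2 - 1 : R)%R.

Lemma measurable_shell_int h : measurable_fun setT h -> (forall w, 0 <= h w)%R ->
  measurable_fun setT (shell_int h).
Proof. by move=> mh h0; rewrite /shell_int; meas; pos. Qed.

Lemma maximal_bound (p : R) : (d%:R < p * n.+1%:R)%R ->
  exists2 C : R, (0 < C)%R & forall psi, measurable_fun setT psi -> (forall w, 0 <= psi w)%R ->
  exists2 Psi : R -> \bar R, measurable_fun setT Psi /\ (forall r, 0 <= Psi r) &
  (forall r t l : R, (0 < r)%R -> (1 <= t <= 2)%R -> (0 < l)%R ->
     l%:E < sphA n psi r t -> (l `^ p)%:E <= Psi r /\
     (l `^ p)%:E <= (C * (1 + r^-1))%:E * wnorm n (fun w => psi w `^ p)%R) /\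
  \int[mu]_r (((0 < r)%R%:R * (1 + `|r| ^+ n.+1))%:E * Psi r) <= C%:E * wnorm n (fun w => psi w `^ p)%R.
Proof.
move=> hp.
have D0 : (0 < n.+1%:R :> R)%R by rewrite ltr0n.
pose p0 := (d%:R / n.+1%:R : R)%R.
have p0p : (p0 < p)%R by rewrite /p0 ltr_pdivrMr.
(* The midpoint of d/(d-1) and p is admissible for the weak bound and still strictly below p. *)
pose p1 := ((p0 + p) / 2)%R.
have p1p : (p1 < p)%R by rewrite /p1; lra.
have hp1 : (d%:R < p1 * n.+1%:R)%R by rewrite -ltr_pdivrMr// -/p0 /p1; lra.
have [Cn Cn0 Hn] := near_bound hp1 p1p.
have [Cw Cw0 Hw] := sphA_weak hp.
pose k1 : R := (2 * Cn)%R.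
pose k2 : R := ((1 + 4 ^+ n.+1) * (4 - 2^-1) * Cw)%R.
pose k3 : R := (Cw * pw e 2 * (2 ^+ n.+1 * 4))%R.
pose k4 : R := (Cw * (1 + pw e 8))%R.
have k10 : (0 < k1)%R by rewrite /k1; lra.
have f4 : (0 < 4 ^+ n.+1 :> R)%R by rewrite exprn_gt0.
have k20 : (0 < k2)%R by rewrite /k2 mulr_gt0// mulr_gt0//; lra.
have k30 : (0 < k3)%R by rewrite /k3 !mulr_gt0// ?pw_gt0// exprn_gt0.
have p8 : (0 <= pw e 8 :> R)%R by exact: pw_ge0.
have k40 : (0 < k4)%R by rewrite /k4 mulr_gt0//; lra.
exists (k1 + k2 + k3 + k4)%R; first by lra.
move=> psi mpsi psi0.
pose h (w : R) := (psi w `^ p)%R.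
have mh : measurable_fun setT h by rewrite /h; meas.
have h0 w : (0 <= h w)%R by exact: powR_ge0.
have [Psi1 [mPsi1 Psi10] [near_pt near_int]] := Hn _ mpsi psi0.
rewrite -/h in near_int *.
set N := wnorm n h in near_int *.
have N0 : 0 <= N by rewrite /N /wnorm; pos.
have msh := measurable_shell_int mh h0.
have sh0 r : 0 <= shell_int h r by rewrite /shell_int; pos.
pose P1 (r : R) : \bar R := (((0 < r)%R && (r < 2^-1)%R)%:R : R)%:E * Psi1 r.
(* On this bounded range the weight is at most 1 + 4^(n+1), so a constant majorant is good
   enough. *)
pose P2 (r : R) : \bar R := (((2^-1 <= r)%R && (r < 4)%R)%:R : R)%:E * (Cw%:E * N).
pose P3 (r : R) : \bar R := ((4 <= r)%R%:R * (Cw * pw e 2 * pw (-1) r))%:E * shell_int h r.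
have P10 r : 0 <= P1 r by rewrite /P1; pos.
have P20 r : 0 <= P2 r by rewrite /P2; pos.
have P30 r : 0 <= P3 r by rewrite /P3; pos.
have mP1 : measurable_fun setT P1 by rewrite /P1; meas.
have mP2 : measurable_fun setT P2 by rewrite /P2; meas.
have mP3 : measurable_fun setT P3 by rewrite /P3; meas.
exists (fun r => P1 r + P2 r + P3 r).
  split; first by meas.
  by pos.
split.
  move=> r t l r0 t12 l0 lA.
  have lX := Hw psi mpsi psi0 r t l l0 (ltW lA).
  rewrite -/h in lX.
  have ri : (0 <= r^-1 :> R)%R by rewrite invr_ge0 ltW.
  split; last first.
    apply: (le_trans lX).
    apply: (le_trans (lee_wpmul2l _ (sphX_le n mh h0 r0 t12))); first by rewrite lee_fin ltW.
    rewrite muleA -EFinM -/N; apply: lee_wpmul2r; first exact: N0.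
    rewrite lee_fin mulrA -/k4; apply: ler_wpM2r; first by lra.
    by lra.
  have [r2|r2] := ltrP r (2^-1)%R.
    apply: (@le_trans _ _ (P1 r)); last by rewrite -addeA leeDl// adde_ge0.
    rewrite /P1 r0 r2 mul1e; apply: (near_pt r t l) => //.
    by rewrite r0.
  have [r4|r4] := ltrP r 4%R.
    apply: (@le_trans _ _ (P2 r)); last by rewrite addeAC leeDr// adde_ge0.
    rewrite /P2 r4 r2 mul1e; apply: (le_trans lX).
    apply: lee_wpmul2l; first by rewrite lee_fin ltW.
    by apply: sphX_far => //; case/andP: t12.
  apply: (@le_trans _ _ (P3 r)); last by rewrite leeDr// adde_ge0.
  rewrite /P3 r4 mul1r; apply: (le_trans lX).
  apply: (le_trans (lee_wpmul2l _ (sphX_tail n mh h0 r4 t12))); first by rewrite lee_fin ltW.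
  by rewrite muleA -EFinM (pwE (-1) r0) powR_inv1 ?(ltW r0)// mulrA.
pose w0 (r : R) := ((0 < r)%R%:R * (1 + `|r| ^+ n.+1))%R.
have w00 r : (0 <= w0 r)%R by rewrite /w0; pos.
have mw0 : measurable_fun setT w0 by rewrite /w0; meas.
rewrite (_ : \int[mu]_r _ = \int[mu]_r ((w0 r)%:E * P1 r) + \int[mu]_r ((w0 r)%:E * P2 r) + \int[mu]_r ((w0 r)%:E * P3 r)); last first.
  rewrite -ge0_integralD; [|by []|by pos|by meas|by pos|by meas].
  rewrite -ge0_integralD; [|by []|by pos|by meas|by pos|by meas].
  apply: eq_integral => r _; rewrite ge0_muleDr ?adde_ge0//.
  by rewrite ge0_muleDr.
apply: (@le_trans _ _ (k1%:E * N + k2%:E * N + k3%:E * N)); last first.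
  rewrite -!ge0_muleDl ?adde_ge0 ?lee_fin ?(ltW k10) ?(ltW k20) ?(ltW k30)//.
  by rewrite lee_wpmul2r// -!EFinD lee_fin; lra.
apply: leeD; first apply: leeD.
- rewrite /k1 EFinM -muleA.
  apply: (@le_trans _ _ (2%:E * \int[mu]_r (((0 < r)%R%:R)%:E * Psi1 r))); last by apply: lee_wpmul2l; [by []|exact: near_int].
  rewrite (_ : _ * \int[mu]_r _ = \int[mu]_r (2%:E * (((0 < r)%R%:R)%:E * Psi1 r))); last first.
    by apply/esym/ge0_integralZl_ext; [by meas|by pos|by []|by []].
  apply: le_integral_nonmeas => r; first by pos.
  rewrite /P1 !muleA; apply: lee_wpmul2r => //.
  rewrite -!EFinM lee_fin /w0; have [r0|r0] := ltrP 0%R r; last by rewrite !mul0r mulr0.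
  case: ltP => r2; last by rewrite mulr0; pos.
  rewrite !mul1r !mulr1 ger0_norm ?(ltW r0)//.
  have : (r ^+ n.+1 <= 1)%R by rewrite exprn_ile1 ?(ltW r0)//; lra.
  by lra.
- apply: (@le_trans _ _ (\int[mu]_r ((Cw%:E * N) * (((2^-1 <= r) && (r <= 4))%R%:R * (1 + 4 ^+ n.+1))%:E))).
    apply: le_integral_nonmeas => r; first by pos.
    rewrite /P2 muleA muleC; apply: lee_wpmul2l; first by pos.
    rewrite -EFinM lee_fin /w0; have [r2|r2] := lerP (2^-1)%R r; last by rewrite mulr0 mul0r.
    have r0 : (0 < r)%R by lra.
    rewrite r0 mul1r; case: ltP => r4; last by rewrite mulr0; pos.
    rewrite (ltW r4) mulr1 mul1r lerD2l ger0_norm ?(ltW r0)//.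
    by rewrite lerXn2r// ?nnegrE ?(ltW r4)// ltW.
  rewrite ge0_integralZl; [|by []|by meas|by pos|by pos].
  rewrite integral_box; [|lra|lra].
  by rewrite muleC muleA -EFinM -/k2.
- rewrite /k3.
  rewrite (_ : \int[mu]_r _ = (Cw * pw e 2)%:E * \int[mu]_r (((4 <= r)%R%:R * (pw (-1) r * (1 + r ^+ n.+1)))%:E * shell_int h r)).
    rewrite [leRHS](_ : _ = (Cw * pw e 2)%:E * ((2 ^+ n.+1 * 4)%:E * N)); last by rewrite EFinM muleA.
    apply: lee_wpmul2l; first by rewrite lee_fin; apply: mulr_ge0; [exact: ltW|exact: pw_ge0].
    exact: tail_bound.
  have mm : measurable_fun setT (fun r : R => ((4 <= r)%R%:R * (pw (-1) r * (1 + r ^+ n.+1)))%:E * shell_int h r) by meas.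
  have nn (r : R) : 0 <= ((4 <= r)%R%:R * (pw (-1) r * (1 + r ^+ n.+1)))%:E * shell_int h r.
    apply: mule_ge0 => //; rewrite lee_fin; have [r4|r4] := lerP 4%R r; last by rewrite mul0r.
    have r0 : (0 <= r)%R by lra.
    by pos.
  apply: (ge0_integralZl_ext mm nn) => [|r]; first by rewrite lee_fin; apply: mulr_ge0; [exact: ltW|exact: pw_ge0].
  rewrite /P3 !muleA -!EFinM /w0; congr (_%:E * _).
  have [r4|r4] := lerP 4%R r; last by rewrite !(mul0r, mulr0).
  have r0 : (0 < r)%R by lra.
  by rewrite r0 /= !mul1r ger0_norm ?(ltW r0)//; ring.
Qed.

End MaximalBound.

(** * Sufficiency for finite p *)

Section UpperBound.
Variables (R : realType) (n : nat).
Local Notation d := n.+2.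
Implicit Types (psi h : R -> R).
Local Open Scope ereal_scope.

Lemma ge0_le_poweR (s : R) (x y : \bar R) : (0 <= s)%R -> 0 <= x -> x <= y -> x `^ s <= y `^ s.
Proof.
move=> s0 x0 xy; have mem (u : \bar R) : 0 <= u -> u \in `[0, +oo].
  by move=> u0; rewrite in_itv/= u0 leey.
by apply: (gt0_ler_poweR s0) => //; apply: mem => //; exact: le_trans xy.
Qed.

(** Reduces a bound on a power of a supremum, possibly infinite, to real levels strictly below it;
    each such level is exceeded by a single mean. *)
Lemma poweR_le_lt (y z : \bar R) (s : R) : (0 < s)%R -> 0 <= y -> 0 <= z ->
  (forall l : R, (0 < l)%R -> l%:E < y -> (l `^ s)%:E <= z) -> y `^ s <= z.
Proof.
move=> s0 y0; case: z => [z| |] // z0 H; last by rewrite leey.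
rewrite lee_fin in z0; rewrite leNgt; apply/negP => zy.
have zy' : ((z `^ s^-1)%R)%:E < y.
  rewrite ltNge; apply/negP => yz; move: zy; apply/negP; rewrite -leNgt.
  have := ge0_le_poweR (ltW s0) y0 yz.
  by rewrite poweR_EFin -powRrM mulVf ?gt_eqF// powRr1.
have z'0 : (0 <= z `^ s^-1)%R by exact: powR_ge0.
have [l zl ly] : exists2 l : R, (z `^ s^-1 < l)%R & l%:E < y.
  move: y {H zy} y0 zy' => [y| |] // _.
    rewrite lte_fin => zy; exists ((z `^ s^-1 + y) / 2)%R; first by lra.
    by rewrite lte_fin; lra.
  by move=> _; exists (z `^ s^-1 + 1)%R; [lra|rewrite ltry].
have l0 : (0 < l)%R by lra.
have := H l l0 ly; rewrite lee_fin leNgt => /negP; apply.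
have := gt0_ltr_powR s0 _ _ zl; rewrite !nnegrE z'0 (ltW l0) => /(_ isT isT).
by rewrite -powRrM mulVf ?gt_eqF// powRr1.
Qed.

(** The value +oo at the origin allows majorants that are valid for r > 0 only. It costs nothing:
    [pw] vanishes at 0 and +oo * 0 = 0. *)
Lemma integ_radial_polar : exists2 k : R, (0 < k)%R & forall T : R -> \bar R,
  measurable_fun setT T -> (forall r, 0 <= T r) ->
  integ (fun x : 'rV[R]_d => if enorm x == 0%R then +oo else T (enorm x)) =
  k%:E * \int[mu]_r (T r * (pw n.+1%:R r)%:E).
Proof.
have [k k0 H] := @integ_radial R n.
have [c c0 Hc] := integral_sqr_haar R.
exists (k / c)%R; first by rewrite divr_gt0.
move=> T mT T0.
pose g (w : R) : \bar R := if (w == 0)%R then +oo else T (Num.sqrt w).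
have mg : measurable_fun setT g by rewrite /g; meas.
have g0 w : 0 <= g w by rewrite /g; case: ifP => // _; rewrite leey.
transitivity (integ (fun x : 'rV[R]_d => g (enorm x ^+ 2)%R)).
  congr integ; apply/funext => x; rewrite /g sqrf_eq0; case: ifP => // _.
  by rewrite sqrtr_sqr ger0_norm// enorm_ge0.
rewrite (H g mg g0) EFinM -muleA; congr (_ * _).
rewrite (_ : \int[mu]_r (T r * _) = c%:E * \int[mu]_w (g w * (pw (d%:R / 2 - 1) w)%:E)).
  by rewrite muleA -EFinM mulVf ?mul1e// gt_eqF.
rewrite [X in _ = _ * X](_ : _ = \int[mu]_w (T (Num.sqrt w) * (pw (d%:R / 2) w)%:E * (pw (-1) w)%:E)); last first.
  apply: eq_integral => w _; rewrite pwD EFinM muleA.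
  have [w0|w0] := lerP w 0%R; first by rewrite !(pw_le0 _ w0) !mule0.
  by rewrite /g gt_eqF.
rewrite -(Hc (fun w => T (Num.sqrt w) * (pw (d%:R / 2) w)%:E)); [|by meas|by pos].
apply: eq_integral => r _.
have [r0|r0] := lerP r 0%R; first by rewrite !(pw_le0 _ r0) !mule0.
rewrite sqrtr_sqr ger0_norm ?(ltW r0)// -muleA -EFinM; congr (_ * _%:E).
rewrite expr2 pwM// -!pwD; congr pw.
by rewrite -(natr1 n.+1); lra.
Qed.

Lemma Lnorm_rec_radial : exists2 k : R, (0 < k)%R & forall (a : R) (f : 'rV[R]_d -> R),
  (0 < a)%R -> borel_fun f -> radial f ->
  Lnorm_rec a (fun x => (f x)%:E) = (k%:E * wnorm n (fun w => `|profile f w| `^ a^-1)%R) `^ a.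
Proof.
have [k k0 H] := @integ_radial R n.
exists k; first exact: k0.
move=> a f a0 bf rf; rewrite /Lnorm_rec gt_eqF//.
have mphi := measurable_profile bf.
congr (_ `^ _).
rewrite (_ : (fun x => _) = (fun x : 'rV[R]_d => ((`|profile f (enorm x ^+ 2)| `^ a^-1)%R)%:E)); last first.
  by apply/funext => x /=; rewrite -profileE.
by rewrite (H (fun w => ((`|profile f w| `^ a^-1)%R)%:E)); [|by meas|by pos].
Qed.

Lemma MaxE_ge0 (E : set R) (f : 'rV[R]_d -> R) x : E !=set0 -> 0 <= MaxE E f x.
Proof.
move=> [t Et]; apply: (@le_trans _ _ `|sph_avg t f x|); first exact: abse_ge0.
by apply: ereal_sup_ubound; exists t.
Qed.

Lemma MaxE_le_sphA : exists2 c : R, (0 < c)%R & forall f : 'rV[R]_d -> R,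
  borel_fun f -> radial f -> forall t x,
  `|sph_avg t f x| <= c%:E * sphA n (fun w => `|profile f w|)%R (enorm x) t.
Proof.
have [c c0 H] := @sph_avg_radial R n.
exists c; first exact: c0.
move=> f bf rf t x; have mphi := measurable_profile bf.
rewrite -(H (fun w => `|profile f w|)%R); [|by meas|by pos].
apply: (le_trans (sph_avg_abse _ _ _)).
rewrite (_ : (fun z => _) = (fun z : 'rV[R]_d => `|profile f (enorm z ^+ 2)|)%R)//.
by apply/funext => z; rewrite -profileE.
Qed.

Local Notation E12 := (`[1%R, 2%R]%classic : set R).

Lemma bounded_rad_pos (a b : R) : (0 < a)%R -> (a * d%:R < n.+1%:R)%R ->
  (a <= b * d%:R)%R -> (b <= a)%R -> bounded_rad d E12 a b.
Proof.
move=> a0 ad abd ba.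
have b0 : (0 < b)%R.
  by rewrite -(pmulr_lgt0 _ (_ : 0 < d%:R)%R)//; lra.
have hp : (d%:R < a^-1 * n.+1%:R)%R by rewrite mulrC ltr_pdivlMr// mulrC.
have [C C0 HC] := maximal_bound hp.
have [k k0 Hk] := Lnorm_rec_radial.
have [kp kp0 Hkp] := integ_radial_polar.
have [c c0 Hc] := MaxE_le_sphA.
(* This is q/p; the hypotheses on a and b say that 1 <= q/p <= d. *)
pose kap := (a / b)%R.
have kap1 : (1 <= kap)%R by rewrite /kap ler_pdivlMr// mul1r.
have kapd : (kap - 1 <= n.+1%:R)%R.
  by rewrite lerBlDr natr1 /kap ler_pdivrMr// mulrC.
have kap0 : (0 <= kap - 1)%R by lra.
pose D := (kp * (c `^ b^-1 * ((2 * C) `^ (kap - 1)) * C))%R.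
have D0 : (0 < D)%R.
  by rewrite /D mulr_gt0// mulr_gt0// mulr_gt0// powR_gt0//; lra.
(* D bounds the integral of the q-th power by y^(q/p). The power b takes the q-th root, and k^a
   undoes the constant in the norm of f. *)
exists (D `^ b / k `^ a)%R => f bf rf fin.
have mphi := measurable_profile bf.
rewrite (Hk a f a0 bf rf) in fin *.
set N := wnorm n _ in fin *.
have N0 : 0 <= N by rewrite /N /wnorm; pos.
have Nfin : N \is a fin_num.
  rewrite ge0_fin_numE//.
  have := lty_poweRy (lt0r_neq0 a0) fin.
  move: (N) N0 => [y| |] //; first by move=> _ _; rewrite ltry.
  by move=> _; rewrite gt0_muley ?lte_fin.
pose y := fine N.
have y0 : (0 <= y)%R by exact: fine_ge0.
have NE : N = y%:E by rewrite fineK.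
have mpsi : measurable_fun setT (fun w => `|profile f w|)%R by meas.
have [Psi [mPsi Psi0] [Hpt Hint]] := HC _ mpsi (fun w => normr_ge0 _).
rewrite -/N in Hpt Hint.
pose q := b^-1%R.
have q0 : (0 < q)%R by rewrite invr_gt0.
(* In M^q = M^(q-p) M^p the first factor takes the pointwise bound and the second the integrable
   majorant; c converts [sphA] into the actual mean. *)
pose T (r : R) : \bar R := (c `^ q * ((C * (1 + pw (-1) r) * y) `^ (kap - 1)))%:E * Psi r.
have mT : measurable_fun setT T by rewrite /T; meas.
have T0 r : 0 <= T r by rewrite /T; pos.
have M0 x : 0 <= MaxE E12 f x.
  by apply: MaxE_ge0; exists 1%R; rewrite /= in_itv/= lexx ler1n.
have MT x : (`|MaxE E12 f x| `^ q) <= (if enorm x == 0%R then +oo else T (enorm x)).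
  rewrite gee0_abs//; case: ifPn => [_|x0]; first by rewrite leey.
  have r0 : (0 < enorm x)%R by rewrite lt_neqAle eq_sym x0 enorm_ge0.
  apply: (poweR_le_lt q0 (M0 x) (T0 _)) => l l0 lM.
  have [_ [t t12 <-] lt] := ereal_sup_gt lM.
  rewrite /= in_itv/= in t12.
  have lS : ((l / c)%R)%:E < sphA n (fun w => `|profile f w|)%R (enorm x) t.
    have := lt_le_trans lt (Hc f bf rf t x).
    move: (sphA _ _ _ _) => [z| |]//=.
    - by rewrite -EFinM !lte_fin => lz; rewrite ltr_pdivrMr// mulrC.
    - by move=> _; rewrite ltry.
    - by rewrite gt0_muleNy ?lte_fin.
  have lc0 : (0 < l / c)%R by rewrite divr_gt0.
  have [u1 u2] := Hpt (enorm x) t (l / c)%R r0 t12 lc0 lS.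
  set u := ((l / c) `^ a^-1)%R in u1 u2.
  have u0 : (0 <= u)%R by exact: powR_ge0.
  have lE : (l `^ q = c `^ q * (u `^ (kap - 1)) * u)%R.
    rewrite -mulrA (mulrC _ u) mulr_powRB1//; last by lra.
    rewrite /u -powRrM (_ : a^-1 * kap = q)%R; last first.
      by rewrite /kap /q; field; rewrite !gt_eqF.
    rewrite -powRM ?(ltW c0) ?(ltW lc0)//; congr (powR _ _).
    by field; rewrite gt_eqF.
  rewrite lE EFinM; apply: lee_pmul => //; first by rewrite lee_fin mulr_ge0 ?powR_ge0.
  rewrite lee_fin; apply: ler_wpM2l; first exact: powR_ge0.
  rewrite NE -EFinM lee_fin in u2.
  rewrite (pwE _ r0) powR_inv1 ?(ltW r0)//.
  by apply: ge0_ler_powR => //; rewrite nnegrE// (le_trans u0).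
have I1 : integ (fun x => `|MaxE E12 f x| `^ q) <= (D * y `^ kap)%:E.
  apply: (le_trans (le_integ _ MT)); first by move=> x; exact: poweR_ge0.
  rewrite (Hkp T mT T0).
  pose K := (c `^ q * ((2 * C) `^ (kap - 1) * y `^ (kap - 1)))%R.
  have K0 : (0 <= K)%R by rewrite /K; pos.
  apply: (@le_trans _ _ (kp%:E * (K%:E * (C%:E * N)))); last first.
    rewrite NE -!EFinM lee_fin /D /K /q -(mulr_powRB1 y0 (_ : 0 < kap)%R); last by lra.
    by apply: eq_ler; ring.
  apply: lee_wpmul2l; first by rewrite lee_fin ltW.
  apply: (@le_trans _ _ (K%:E * \int[mu]_r (((0 < r)%R%:R * (1 + `|r| ^+ n.+1))%:E * Psi r))); last first.
    by apply: lee_wpmul2l => //; rewrite lee_fin.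
  rewrite [leRHS](_ : _ = \int[mu]_r (K%:E * (((0 < r)%R%:R * (1 + `|r| ^+ n.+1))%:E * Psi r))); last first.
    by apply/esym/ge0_integralZl_ext; [by meas|by pos|by rewrite lee_fin|].
  apply: le_integral_nonmeas => r; first by pos.
  rewrite /T muleAC muleA; apply: lee_wpmul2r => //.
  rewrite -!EFinM lee_fin.
  have [r0|r0] := lerP r 0%R; first by rewrite !(pw_le0 _ r0) mulr0; pos.
  rewrite mul1r (pwE _ r0) (pwE _ r0) powR_mulrn ?(ltW r0)// powR_inv1 ?(ltW r0)// ger0_norm ?(ltW r0)//.
  rewrite /K -[leLHS]mulrA -[leRHS]mulrA; apply: ler_wpM2l; first exact: powR_ge0.
  have ri0 : (0 <= r^-1)%R by rewrite invr_ge0 ltW.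
  set Y := (y `^ (kap - 1))%R; set CC := (C `^ (kap - 1))%R.
  have -> : ((C * (1 + r^-1) * y) `^ (kap - 1) = CC * Y * (1 + r^-1) `^ (kap - 1))%R.
    rewrite powRM; [|by pos|by pos].
    rewrite powRM; [|by pos|by pos].
    by rewrite mulrAC.
  have -> : ((2 * C) `^ (kap - 1) = CC * 2 `^ (kap - 1))%R.
    by rewrite powRM ?(ltW C0)// mulrC.
  (* For r >= 1 use 1 + 1/r <= 2. For r < 1 use 1 + 1/r <= 2/r; the remaining power of r has
     exponent n + 1 - (kap - 1) >= 0, so it is at most 1. *)
  suff H : ((1 + r^-1) `^ (kap - 1) * r ^+ n.+1 <= 2 `^ (kap - 1) * (1 + r ^+ n.+1))%R.
    have CY : (0 <= CC * Y)%R by rewrite mulr_ge0// powR_ge0.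
    rewrite (_ : CC * Y * _ * _ = (CC * Y) * ((1 + r^-1) `^ (kap - 1) * r ^+ n.+1))%R; last by ring.
    rewrite (_ : CC * 2 `^ _ * Y * _ = (CC * Y) * (2 `^ (kap - 1) * (1 + r ^+ n.+1)))%R; last by ring.
    exact: ler_wpM2l.
  have rn0 : (0 <= r ^+ n.+1)%R by rewrite exprn_ge0// ltW.
  have [r1|r1] := lerP 1%R r.
    apply: ler_pM => //; [exact: powR_ge0| |by lra].
    apply: ge0_ler_powR => //; rewrite ?nnegrE; [by lra|by lra|].
    have : (r^-1 <= 1)%R by rewrite invf_le1.
    by lra.
  apply: (@le_trans _ _ ((2 * r^-1) `^ (kap - 1) * r ^+ n.+1)%R).
    apply: ler_wpM2r => //; apply: ge0_ler_powR => //; rewrite ?nnegrE; [by lra|by lra|].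
    have : (1 <= r^-1)%R by rewrite invf_ge1// ltW.
    by lra.
  rewrite powRM// -mulrA; apply: ler_wpM2l; first exact: powR_ge0.
  rewrite -(powR_inv1 (ltW r0)) -powRrM -(powR_mulrn _ (ltW r0)) -powRD; last first.
    by rewrite (gt_eqF r0) implybT.
  apply: (@le_trans _ _ 1%R); last by rewrite lerDl powR_ge0.
  rewrite -[leRHS](powRr0 r); apply: ger_powR; first by rewrite r0 ltW.
  by lra.
rewrite [X in X <= _](_ : _ = integ (fun x => `|MaxE E12 f x| `^ q) `^ b); last first.
  by rewrite /Lnorm_rec (gt_eqF b0).
apply: (le_trans (ge0_le_poweR (ltW b0) _ I1)).
  by apply: integ_ge0 => x; exact: poweR_ge0.
clearbody D.
rewrite NE -EFinM !poweR_EFin lee_fin powRM ?(ltW D0) ?powR_ge0// -powRrM.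
rewrite (_ : kap * b = a)%R; last by rewrite /kap divfK// gt_eqF.
rewrite powRM ?(ltW k0)//; apply: eq_ler.
by field; rewrite gt_eqF// powR_gt0.
Qed.

End UpperBound.

(** * The vertex p = q = infinity *)

Section UpperBoundInfty.
Variables (R : realType) (n : nat).
Local Notation d := n.+2.
Implicit Types (psi h : R -> R).
Local Open Scope ereal_scope.
Local Notation E12 := (`[1%R, 2%R]%classic : set R).

(** Spheres are null sets, so vanishing almost everywhere says nothing about a mean by itself. Here
    the weak bound applies: a mean at r > 0 that reached a level l > 0 would force l^p <= 0. *)
Lemma sphA_null psi (r t : R) : measurable_fun setT psi -> (forall w, 0 <= psi w)%R ->
  (0 < r)%R -> (1 <= t <= 2)%R ->
  (forall p : R, (0 < p)%R -> wnorm n (fun w => psi w `^ p)%R = 0) -> sphA n psi r t = 0.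
Proof.
move=> mpsi psi0 r0 t12 W.
(* p = d + 1 satisfies p (d-1) > d in every dimension d >= 2. *)
have hp : (d%:R < d.+1%:R * n.+1%:R :> R)%R by rewrite -natrM ltr_nat mulnS; exact: leq_addr.
have [C C0 HC] := sphA_weak hp.
have A0 : 0 <= sphA n psi r t by rewrite /sphA; pos.
suff H (l : R) : (0 < l)%R -> ~ l%:E <= sphA n psi r t.
  move: (sphA _ _ _ _) A0 H => [y| |] // y0 H; last by case: (H 1%R ltr01); rewrite leey.
  have := y0; rewrite lee_fin le_eqVlt => /predU1P[<-//|y1].
  by case: (H y y1).
move=> l0 lA; have := HC psi mpsi psi0 r t l l0 lA.
have mh : measurable_fun setT (fun w => psi w `^ d.+1%:R)%R by meas.
have X := sphX_le n mh (fun w => powR_ge0 _ _) r0 t12.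
rewrite W// mule0 in X.
move=> /le_trans/(_ (lee_wpmul2l (_ : 0 <= C%:E) X)).
rewrite mule0 lee_fin ltW// => /(_ isT).
by rewrite lee_fin leNgt powR_gt0.
Qed.

Lemma vol_subset (A B : set 'rV[R]_d) : A `<=` B -> vol A <= vol B.
Proof.
move=> AB; apply: le_integ => x; first by rewrite lee_fin.
rewrite lee_fin !indicE ler_nat; case: (boolP (x \in A)) => //= xA.
by rewrite mem_set//; apply: AB; rewrite inE in xA.
Qed.

Lemma vol_origin : vol [set x : 'rV[R]_d | enorm x = 0%R] = 0.
Proof.
have [k k0 H] := @integ_radial_polar R n.
(* With T = 0 the polar formula integrates the function that is +oo at the origin and 0 elsewhere;
   it dominates the indicator. *)
have := H (fun=> 0) (measurable_cst _) (fun=> lexx _).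
under [X in _ * X]eq_integral do rewrite mul0e.
rewrite integral0 mule0 => H0.
apply/eqP; rewrite eq_le integ_ge0 ?andbT; last by move=> x; rewrite lee_fin.
rewrite -[leRHS]H0; apply: le_integ => x; first by rewrite lee_fin.
rewrite indicE; case: ifPn => [_|x0]; first by rewrite leey.
rewrite lee_fin; case: (boolP (x \in _)) => //.
by rewrite inE /= => xe; rewrite xe eqxx in x0.
Qed.

Lemma ess_bound_wnorm (f : 'rV[R]_d -> R) (m : R) : borel_fun f -> radial f ->
  vol [set x | (m%:E < `|(f x)%:E|)] = 0 ->
  forall p : R, (0 < p)%R ->
  wnorm n (fun w => (`|profile f w| * (m < `|profile f w|)%R%:R) `^ p)%R = 0.
Proof.
move=> bf rf V p p0; have mphi := measurable_profile bf.
have [k k0 H] := @integ_radial R n.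
have I0 : \int[mu]_w (((m < `|profile f w|)%R%:R)%:E * (pw (d%:R / 2 - 1) w)%:E) = 0.
  have : k%:E * \int[mu]_w (((m < `|profile f w|)%R%:R)%:E * (pw (d%:R / 2 - 1) w)%:E) = 0.
    rewrite -(H (fun w => ((m < `|profile f w|)%R%:R)%:E)); [|by meas|by pos].
    rewrite -[RHS]V /vol; congr integ; apply/funext => x.
    by rewrite indicE mem_setE /= -profileE.
  by move/eqP; rewrite mule_eq0 eqe gt_eqF//= => /eqP.
apply/eqP; rewrite eq_le; apply/andP; split; last by rewrite /wnorm; pos.
(* The profile may be unbounded above m, so it is majorized by +oo times the indicator of a set of
   measure zero. *)
rewrite (_ : 0 = \int[mu]_w (+oo * (((m < `|profile f w|)%R%:R)%:E * (pw (d%:R / 2 - 1) w)%:E))); last first.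
  by rewrite ge0_integralZl; [rewrite I0 mule0|by []|by meas|by pos|by rewrite leey].
apply: le_integral_nonmeas => w; first by pos.
case: ltP => mw; last by rewrite mulr0 powR0 ?gt_eqF// mul0r mul0e mule0.
rewrite mul1e; have [w0|w0] := lerP w 0%R; first by rewrite pw_le0// mulr0 mule0.
by rewrite gt0_mulye ?leey// lte_fin pw_gt0.
Qed.

(** Only the origin is exceptional: there a mean is the value of f on one sphere, which an essential
    bound does not control. Elsewhere the part of f above an essential bound m has mean zero, and
    the rest is at most m. *)
Lemma bounded_rad_infty : bounded_rad d E12 (0 : R) (0 : R).
Proof.
have [c c0 Hc] := @MaxE_le_sphA R n.
pose c1 : R := fine (sconst R n).
have c10 : (0 < c1)%R by rewrite -lte_fin fineK ?sconst_fin// sconst_gt0.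
have C0 : (0 < c * c1)%R by rewrite mulr_gt0.
exists (c * c1)%R => f bf rf _.
have mphi := measurable_profile bf.
rewrite /Lnorm_rec eqxx.
rewrite -lee_pdivrMl//; apply: le_ereal_inf_tmp => M [M0 VM].
rewrite lee_pdivrMl//.
case: M M0 VM => [m| |]// m0 VM; last by rewrite gt0_muley ?lte_fin// leey.
apply: ereal_inf_lbound; split; first by pos.
rewrite lee_fin in m0.
apply/eqP; rewrite eq_le integ_ge0 ?andbT; last by move=> x; rewrite lee_fin.
rewrite -[leRHS]vol_origin; apply: vol_subset => x /=.
apply: contraPP => x0; apply/negP; rewrite -leNgt.
have r0 : (0 < enorm x)%R by rewrite lt_neqAle enorm_ge0 eq_sym andbT; apply/eqP.
rewrite gee0_abs; last by apply: MaxE_ge0; exists 1%R; rewrite /= in_itv/= lexx ler1n.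
apply: ge_ereal_sup => _ [t /= + <-]; rewrite in_itv/= => t12.
apply: (le_trans (Hc f bf rf t x)); rewrite EFinM -muleA.
apply: lee_wpmul2l; first by rewrite lee_fin ltW.
have mpsi : measurable_fun setT (fun w => `|profile f w|)%R by meas.
apply: (le_trans (sphA_cut n (enorm x) t mpsi (fun w => normr_ge0 _) m0)).
rewrite (sphA_null _ _ r0 t12).
- by rewrite adde0 -/c1 mulrC EFinM.
- by meas.
- by move=> w; pos.
- exact: (ess_bound_wnorm bf rf VM).
Qed.
End UpperBoundInfty.

(** * A common frame for the counterexamples *)

Section Necessity.
Variables (R : realType) (n : nat).
Local Notation d := n.+2.
Implicit Types (psi h : R -> R).
Local Open Scope ereal_scope.
Local Notation E12 := (`[1%R, 2%R]%classic : set R).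

Lemma powR_growth (s K : R) :
  (forall L0 : R, exists2 L, (L0 <= L)%R & (L `^ s <= K)%R) -> (s <= 0)%R.
Proof.
move=> H; rewrite leNgt; apply/negP => s0.
have [L L0 LK] := H ((`|K| + 1) `^ s^-1)%R.
have K1 : (0 <= `|K| + 1)%R by rewrite addr_ge0.
have := ge0_ler_powR (ltW s0) _ _ L0.
rewrite !nnegrE powR_ge0 (le_trans (powR_ge0 _ _) L0) => /(_ isT isT).
rewrite -powRrM mulVf ?gt_eqF// powRr1// => KL.
have := ler_norm K; lra.
Qed.

(** The bounds are on |x|^2, so u = -1 gives the open ball of radius sqrt v, centre included. *)
Definition ann (u v : R) : set 'rV[R]_d := [set x | (u < enorm x ^+ 2 < v)%R].

Lemma ann_indic u v : (fun x => (\1_(ann u v) x)%:E) =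
  (fun x : 'rV[R]_d => (fun w => (((u < w) && (w < v))%R%:R)%:E) (enorm x ^+ 2)%R) :> (_ -> \bar R).
Proof. by apply/funext => x; rewrite indicE mem_setE. Qed.

Lemma Lnorm_rec_ge (b c0 : R) (g : 'rV[R]_d -> \bar R) u v :
  (0 <= b)%R -> (0 <= c0)%R -> 0 < vol (ann u v) -> (forall x, 0 <= g x) ->
  (forall x, (u < enorm x ^+ 2 < v)%R -> c0%:E <= g x) ->
  c0%:E * (vol (ann u v)) `^ b <= Lnorm_rec b g.
Proof.
move=> b0 c00 V0 g0 cg; rewrite /Lnorm_rec; case: eqVneq => [->|bn0].
  rewrite poweRe0 mule1; apply: le_ereal_inf_tmp => M [M0 VM].
  rewrite leNgt; apply/negP => Mc; move: V0; rewrite ltNge -VM => /negP; apply.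
  apply: vol_subset => x /= /cg cgx; rewrite gee0_abs//.
  exact: lt_le_trans cgx.
have b1 : (0 < b)%R by rewrite lt_neqAle eq_sym bn0.
have [k k0 H] := @integ_radial R n.
have VE : vol (ann u v) = k%:E * \int[mu]_w ((((u < w) && (w < v))%R%:R)%:E * (pw (d%:R / 2 - 1) w)%:E).
  by rewrite /vol ann_indic (H (fun w => (((u < w) && (w < v))%R%:R)%:E)); [|by meas|by pos].
have I : (c0 `^ b^-1)%:E * vol (ann u v) <= integ (fun x => `|g x| `^ b^-1).
  apply: (@le_trans _ _ (integ (fun x : 'rV[R]_d => (fun w => (c0 `^ b^-1 * ((u < w) && (w < v))%R%:R)%:E) (enorm x ^+ 2)%R))).
    rewrite (H (fun w => (c0 `^ b^-1 * ((u < w) && (w < v))%R%:R)%:E)); [|by meas|by pos].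
    rewrite VE muleCA; apply: lee_wpmul2l; first by rewrite lee_fin ltW.
    rewrite -ge0_integralZl; [|by []|by meas|by pos|by pos].
    by apply: le_integral_nonmeas => w; [pos|rewrite muleA EFinM].
  apply: le_integ => x; first by pos.
  case: (boolP (_ && _)) => [/cg cgx|_]; last by rewrite mulr0 poweR_ge0.
  rewrite mulr1 gee0_abs// -poweR_EFin; apply: ge0_le_poweR => //.
  by rewrite invr_ge0.
have c1 : 0 <= (c0 `^ b^-1)%:E by rewrite lee_fin powR_ge0.
have J := ge0_le_poweR b0 (mule_ge0 c1 (ltW V0)) I.
apply: (le_trans _ J).
rewrite (poweRM _ c1 (ltW V0)) poweR_EFin -powRrM mulVf; last exact: bn0.
by rewrite powRr1.
Qed.

Lemma Lnorm_rec_ann (a : R) u v : (0 <= a)%R ->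
  Lnorm_rec a (fun x : 'rV[R]_d => (((u < enorm x ^+ 2) && (enorm x ^+ 2 < v))%R%:R)%:E) <=
  (vol (ann u v)) `^ a.
Proof.
move=> a0; rewrite /Lnorm_rec; case: eqVneq => [->|an0].
  rewrite poweRe0; apply: ereal_inf_lbound; split; first by rewrite lee_fin.
  rewrite (_ : [set x | _] = set0); last first.
    apply/seteqP; split => x //=; rewrite ger0_norm// lte_fin ltNge.
    by rewrite lern1 leq_b1.
  apply/eqP; rewrite eq_le; apply/andP; split; last by apply: integ_ge0 => x; rewrite lee_fin.
  by rewrite -(@vol_origin R n); apply: vol_subset.
rewrite /vol ann_indic; rewrite le_eqVlt; apply/predU1P; left; congr (integ _ `^ _); apply/funext => x /=.
rewrite ger0_norm//; case: (_ && _); first by rewrite powR1.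
by rewrite powR0// invr_eq0.
Qed.

(** Isolates what each counterexample supplies: a profile with norm at most N and, at each radius of
    a fixed annulus, some t for which the mean is at least c0. *)
Lemma bounded_rad_test (a b : R) : (0 <= b)%R -> bounded_rad d E12 a b ->
  exists2 C : R, (0 < C)%R & forall psi u v (c0 N : R),
  measurable_fun setT psi -> (forall w, 0 <= psi w)%R -> (0 <= c0)%R ->
  0 < vol (ann u v) ->
  Lnorm_rec a (fun x : 'rV[R]_d => (psi (enorm x ^+ 2))%:E) <= N%:E ->
  (forall r : R, (0 <= r)%R -> (u < r ^+ 2 < v)%R ->
     exists2 t : R, (1 <= t <= 2)%R & c0%:E <= sphA n psi r t) ->
  c0%:E * (vol (ann u v)) `^ b <= (C * N)%:E.
Proof.
move=> b0 [C HC].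
have [c cpos Hc] := @sph_avg_radial R n.
(* The boundedness constant C may have any sign, hence the passage to |C| + 1 > 0. *)
exists ((`|C| + 1) / c)%R; first by rewrite divr_gt0// ltr_wpDl.
move=> psi u v c0 N mpsi psi0 c00 V0 LN Hr.
have bf := @borel_radial R n psi mpsi.
have rf := @radial_profile R n psi.
have L0 : 0 <= Lnorm_rec a (fun x : 'rV[R]_d => (psi (enorm x ^+ 2))%:E).
  rewrite /Lnorm_rec; case: ifP => _; last exact: poweR_ge0.
  by apply: le_ereal_inf_tmp => M [].
have := HC _ bf rf (le_lt_trans LN (ltry _)).
have : (c * c0)%:E * (vol (ann u v)) `^ b <= Lnorm_rec b (MaxE E12 (fun x : 'rV[R]_d => psi (enorm x ^+ 2)%R)).
  apply: Lnorm_rec_ge => //; first by rewrite mulr_ge0// ltW.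
    by move=> x; apply: MaxE_ge0; exists 1%R; rewrite /= in_itv/= lexx ler1n.
  move=> x /(Hr _ (enorm_ge0 x)) [t t12 ct].
  apply: (@le_trans _ _ `|sph_avg t (fun x : 'rV[R]_d => psi (enorm x ^+ 2)%R) x|).
    rewrite Hc//; apply: (le_trans _ (lee_abs _)).
    by rewrite EFinM; apply: lee_wpmul2l => //; rewrite lee_fin ltW.
  by apply: ereal_sup_ubound; exists t => //; rewrite /= in_itv.
move=> /le_trans H /H {}H.
have {}H : (c * c0)%:E * (vol (ann u v)) `^ b <= ((`|C| + 1) * N)%:E.
  apply: (le_trans H); apply: (@le_trans _ _ ((`|C| + 1)%:E * Lnorm_rec a (fun x : 'rV[R]_d => (psi (enorm x ^+ 2))%:E))).
    by apply: lee_wpmul2r => //; rewrite lee_fin; have := ler_norm C; lra.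
  by rewrite EFinM; apply: lee_wpmul2l => //; rewrite lee_fin addr_ge0.
rewrite (_ : (`|C| + 1) / c * N = c^-1 * ((`|C| + 1) * N))%R; last by ring.
by rewrite EFinM lee_pdivlMl// muleA -EFinM.
Qed.
End Necessity.

(** * Large balls and thin annuli *)

Section PowerTests.
Variables (R : realType) (n : nat).
Local Notation d := n.+2.
Implicit Types (psi h : R -> R).
Local Open Scope ereal_scope.
Local Notation E12 := (`[1%R, 2%R]%classic : set R).
Local Notation e := (d%:R / 2 - 1 : R)%R.
Local Notation gam := (n.+1%:R / 2 - 1 : R)%R.

Lemma powR_compare (c k C K L s t a b : R) :
  (0 < c)%R -> (0 < k)%R -> (0 < C)%R -> (0 < K)%R -> (0 < L)%R ->
  (c * (k * L `^ s) `^ b <= C * (K * L `^ t) `^ a)%R ->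
  (L `^ (s * b - t * a) <= C * K `^ a / (c * k `^ b))%R.
Proof.
move=> c0 k0 C0 K0 L0.
have -> : ((k * L `^ s) `^ b = k `^ b * L `^ (s * b))%R.
  by rewrite powRM ?powR_ge0 ?(ltW k0)// -powRrM.
have -> : ((K * L `^ t) `^ a = K `^ a * L `^ (t * a))%R.
  by rewrite powRM ?powR_ge0 ?(ltW K0)// -powRrM.
rewrite powRB; last by rewrite (gt_eqF L0) implybT.
have La : (0 < L `^ (t * a))%R by rewrite powR_gt0.
have kb : (0 < c * k `^ b)%R by rewrite mulr_gt0// powR_gt0.
by move=> H; rewrite ler_pdivrMr// mulrAC ler_pdivlMr//; lra.
Qed.

Lemma pw_ge_min (a x lo hi : R) : (0 < lo)%R -> (lo <= x <= hi)%R ->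
  (Num.min (pw a lo) (pw a hi) <= pw a x)%R.
Proof.
move=> lo0 /andP[l h]; rewrite ge_min; have [a0|a0] := lerP 0%R a.
  by rewrite ler_pw.
by apply/orP; right; apply: ger_pw; [exact: ltW|exact: lt_le_trans l|].
Qed.

Lemma vol_annE : exists2 k : R, (0 < k)%R & forall u v : R,
  vol (@ann R n u v) = k%:E * \int[mu]_w ((((u < w) && (w < v))%R%:R)%:E * (pw (d%:R / 2 - 1) w)%:E).
Proof.
have [k k0 H] := @integ_radial R n; exists k; first exact: k0.
by move=> u v; rewrite /vol ann_indic (H (fun w => (((u < w) && (w < v))%R%:R)%:E)); [|by meas|by pos].
Qed.

Lemma vol_ann_ball : exists2 k : R, (0 < k)%R & forall L : R, (0 < L)%R ->
  vol (@ann R n (-1) L) = (k * L `^ (d%:R / 2))%:E.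
Proof.
have [k k0 H] := vol_annE.
have d0 : (0 < d%:R / 2 :> R)%R by rewrite divr_gt0.
exists (k * fine (pint (d%:R / 2 : R)))%R.
  by rewrite mulr_gt0// -lte_fin fineK ?pint_fin// pint_gt0.
move=> L L0; rewrite H -mulrA EFinM; congr (_ * _).
rewrite EFinM fineK ?pint_fin// muleC -(pwE _ L0) -integral_pw_lt//; last exact: ltW.
apply: eq_integral => w _; have [w0|w0] := lerP w 0; first by rewrite pw_le0// !mule0.
by have -> : (-1 < w)%R by lra.
Qed.

Lemma vol_ann_thin : exists2 K : R, (0 < K)%R & forall del : R, (0 < del < 1)%R ->
  vol (@ann R n ((1 - del) ^+ 2) ((1 + del) ^+ 2)) <= (K * del)%:E.
Proof.
have [k k0 H] := vol_annE.
have p4 : (0 < pw e 4 :> R)%R by rewrite pw_gt0.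
exists (k * (pw e 4 * 4))%R; first by rewrite !mulr_gt0.
move=> del /andP[d0 d1]; rewrite H -mulrA EFinM.
apply: lee_wpmul2l; first by rewrite lee_fin ltW.
have -> : (pw e 4 * 4 * del = pw e 4 * ((1 + del) ^+ 2 - (1 - del) ^+ 2))%R by ring.
apply: integral_le_box; [by nra|exact: ltW|by pos|move=> w].
rewrite -EFinM lee_fin; case: (boolP (_ && (w < _)%R)) => [/andP[w1 w2]|_]; last by rewrite mul0r; pos.
rewrite (ltW w1) (ltW w2) !mul1r; apply: ler_pw; first exact: e_ge0.
by nra.
Qed.

Lemma vol_ann_shell : exists2 V : R, (0 < V)%R & vol (@ann R n 1 4) = V%:E.
Proof.
have [k k0 H] := vol_annE.
have m0 : (0 < Num.min (pw e 2) (pw e 3) :> R)%R by rewrite lt_min !pw_gt0.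
have V0 : 0 < vol (@ann R n 1 4 : set 'rV[R]_d).
  rewrite H; apply: mule_gt0; first by [].
  apply: (@lt_le_trans _ _ (Num.min (pw e 2) (pw e 3) * (3 - 2))%:E).
    by rewrite lte_fin mulr_gt0//; lra.
  apply: integral_ge_box; [lra|exact: ltW|by pos|move=> x /andP[x2 x3]].
  have -> : ((1 < x) && (x < 4))%R by apply/andP; split; lra.
  by rewrite mul1e lee_fin pw_ge_min// x2.
have Vf : vol (@ann R n 1 4 : set 'rV[R]_d) \is a fin_num.
  rewrite ge0_fin_numE ?(ltW V0)//.
  have [k' k'0 H'] := vol_ann_ball.
  apply: (@le_lt_trans _ _ (vol (@ann R n (-1) 4 : set 'rV[R]_d))).
    by apply: vol_subset => x /= /andP[x1 x4]; rewrite /ann /= x4 andbT; lra.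
  by rewrite H'// ltry.
exists (fine (vol (@ann R n 1 4 : set 'rV[R]_d))); last by rewrite fineK.
by rewrite -lte_fin fineK.
Qed.

Lemma sconst_le_sphA psi (r t : R) : (forall w, 0 <= psi w)%R ->
  (forall v, (-1 < v < 1)%R -> (1 <= psi (r ^+ 2 + t ^+ 2 - 2 * t * r * v))%R) ->
  sconst R n <= sphA n psi r t.
Proof.
move=> psi0 H; apply: le_integral_nonmeas => v; first by pos.
rewrite lee_fin; have [v1|v1] := ltrP 0 (1 - v ^+ 2)%R; last by rewrite pw_le0// mulr0.
rewrite ler_peMl ?pw_ge0// H//; apply/andP; split; nra.
Qed.

Lemma necessary_q_ge_p (a b : R) : (0 <= a)%R -> (0 <= b)%R -> bounded_rad d E12 a b -> (b <= a)%R.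
Proof.
move=> a0 b0 /(bounded_rad_test b0) [C C0 HC].
have [k k0 Hk] := vol_ann_ball.
pose c1 : R := fine (sconst R n).
have c10 : (0 < c1)%R by rewrite -lte_fin fineK ?sconst_fin// sconst_gt0.
suff G : (d%:R / 2 * b - d%:R / 2 * a <= 0)%R.
  by rewrite -subr_le0 -(pmulr_rle0 _ (_ : 0 < d%:R / 2)%R) ?divr_gt0// mulrBr.
pose k' : R := (k * (4^-1) `^ (d%:R / 2))%R.
have k'0 : (0 < k')%R by rewrite mulr_gt0// powR_gt0// invr_gt0.
apply: (@powR_growth _ _ (C * k `^ a / (c1 * k' `^ b))%R) => L0.
(* L is the squared radius of the ball. With L >= 16, |x| < (sqrt L)/2 and t = 1 <= (sqrt L)/4, the
   whole sphere lies in the ball. *)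
pose L : R := (Num.max L0 16)%R.
have L16 : (16 <= L)%R by rewrite le_max lexx orbT.
have Lp : (0 < L)%R by lra.
exists L; first by rewrite le_max lexx.
apply: powR_compare => //.
pose psi (w : R) : R := ((-1 < w) && (w < L))%R%:R.
have mpsi : measurable_fun setT psi by rewrite /psi; meas.
have psi0 w : (0 <= psi w)%R by rewrite /psi.
have L4 : (0 < L * 4^-1)%R by rewrite mulr_gt0// invr_gt0.
have := HC psi (-1)%R (L * 4^-1)%R c1 ((k * L `^ (d%:R / 2)) `^ a)%R mpsi psi0 (ltW c10).
rewrite (Hk _ L4) lte_fin mulr_gt0 ?powR_gt0// poweR_EFin -EFinM lee_fin.
have -> : (k * (L * 4^-1) `^ (d%:R / 2) = k' * L `^ (d%:R / 2))%R.
  by rewrite /k' powRM ?(ltW Lp)// ?invr_ge0// mulrA mulrAC.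
apply => //.
  by rewrite -poweR_EFin -Hk//; exact: Lnorm_rec_ann.
move=> r r0 /andP[_ rL]; exists 1%R; first by rewrite lexx ler1n.
rewrite fineK ?sconst_fin//; apply: sconst_le_sphA => // v /andP[v1 v2].
rewrite /psi; suff -> : ((-1 < r ^+ 2 + 1 ^+ 2 - 2 * 1 * r * v) && (r ^+ 2 + 1 ^+ 2 - 2 * 1 * r * v < L))%R by [].
have h2 : (0 <= r * (1 - v))%R by rewrite mulr_ge0//; lra.
have h3 : (0 <= r * (1 + v))%R by rewrite mulr_ge0//; lra.
have h4 := sqr_ge0 (r - 1)%R.
apply/andP; split; nra.
Qed.

Lemma necessary_q_le_dp (a b : R) : (0 <= a)%R -> (0 <= b)%R -> bounded_rad d E12 a b ->
  (a <= b * d%:R)%R.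
Proof.
move=> a0 b0 /(bounded_rad_test b0) [C C0 HC].
have [k k0 Hk] := vol_ann_ball.
have [K K0 HK] := vol_ann_thin.
pose c1 : R := fine (sconst R n).
have c10 : (0 < c1)%R by rewrite -lte_fin fineK ?sconst_fin// sconst_gt0.
suff G : (- d%:R * b - (-1) * a <= 0)%R by lra.
apply: (@powR_growth _ _ (C * K `^ a / (c1 * k `^ b))%R) => L0.
pose L : R := (Num.max L0 2)%R.
have L2 : (2 <= L)%R by rewrite le_max lexx orbT.
have Lp : (0 < L)%R by lra.
exists L; first by rewrite le_max lexx.
apply: powR_compare => //.
(* The small width is written as 1/L so that [powR_growth] can let L grow. For |x| < del the unit
   sphere about x lies in the annulus, by the triangle inequality. *)
pose del : R := L^-1%R.
have d0 : (0 < del)%R by rewrite invr_gt0.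
have d1 : (del < 1)%R by rewrite invf_lt1//; lra.
pose u : R := ((1 - del) ^+ 2)%R; pose v : R := ((1 + del) ^+ 2)%R.
pose psi (w : R) : R := ((u < w) && (w < v))%R%:R.
have mpsi : measurable_fun setT psi by rewrite /psi; meas.
have psi0 w : (0 <= psi w)%R by rewrite /psi.
have dd0 : (0 < del ^+ 2)%R by rewrite exprn_gt0.
have := HC psi (-1)%R (del ^+ 2)%R c1 ((K * del) `^ a)%R mpsi psi0 (ltW c10).
rewrite (Hk _ dd0) lte_fin mulr_gt0 ?powR_gt0// poweR_EFin -EFinM lee_fin.
have -> : ((del ^+ 2) `^ (d%:R / 2) = L `^ (- d%:R))%R.
  rewrite -(powR_mulrn _ (ltW d0)) -powRrM mulrC divfK// powRN /del.
  by rewrite -(powR_inv1 (ltW Lp)) -powRrM mulN1r powRN.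
have -> : (L `^ (-1) = del)%R by rewrite powR_inv1// ltW.
apply => //.
  rewrite -poweR_EFin; apply: (le_trans (Lnorm_rec_ann _ _ _ a0)).
  apply: ge0_le_poweR => //; last by apply: HK; rewrite d0.
  by apply: integ_ge0 => x; rewrite lee_fin.
move=> r r0 /andP[_ rL]; exists 1%R; first by rewrite lexx ler1n.
have rd : (r < del)%R by nra.
rewrite fineK ?sconst_fin//; apply: sconst_le_sphA => // w /andP[w1 w2].
rewrite /psi /u /v; suff -> : (((1 - del) ^+ 2 < r ^+ 2 + 1 ^+ 2 - 2 * 1 * r * w) && (r ^+ 2 + 1 ^+ 2 - 2 * 1 * r * w < (1 + del) ^+ 2))%R by [].
have h1 : (0 < (del - r) * (2 - del - r))%R by rewrite mulr_gt0//; lra.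
have h2 : (0 <= r * (1 - w))%R by rewrite mulr_ge0//; lra.
have h3 : (0 <= r * (1 + w))%R by rewrite mulr_ge0//; lra.
apply/andP; split; nra.
Qed.
End PowerTests.

(** * Logarithmic growth of means through the singularity *)

Section LogarithmicTest.
Variables (R : realType) (n : nat).
Local Notation d := n.+2.
Implicit Types (psi h : R -> R).
Local Open Scope ereal_scope.
Local Notation E12 := (`[1%R, 2%R]%classic : set R).
Local Notation e := (d%:R / 2 - 1 : R)%R.
Local Notation gam := (n.+1%:R / 2 - 1 : R)%R.

(** This is log (1/eps) for 0 < eps < 1; its growth is read off from dyadic values of eps. *)
Definition log_int (eps : R) : \bar R :=
  \int[mu]_w (((eps < w) && (w < 1))%R%:R * pw (-1) w)%:E.

Lemma log_int_ge0 eps : 0 <= log_int eps. Proof. by rewrite /log_int; pos. Qed.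

Lemma log_int_lty eps : (0 < eps < 1)%R -> log_int eps < +oo.
Proof.
move=> /andP[e0 e1].
apply: (@le_lt_trans _ _ (pw (-1) eps * (1 - eps))%:E); last by rewrite ltry.
apply: integral_le_box; [exact: ltW|exact: pw_ge0|by pos|move=> w].
rewrite lee_fin; case: (boolP (_ && (w < _)%R)) => [/andP[w1 w2]|_]; last by rewrite mul0r; pos.
by rewrite (ltW w1) (ltW w2) !mul1r; apply: ger_pw => //; exact: ltW.
Qed.

Lemma log_int_half : (8^-1)%:E <= log_int 2^-1.
Proof.
have -> : (8^-1 = 1 * (7/8 - 3/4) :> R)%R by lra.
apply: integral_ge_box; [lra|by []|by pos|move=> w /andP[w1 w2]].
have -> : ((2^-1 < w) && (w < 1))%R by apply/andP; split; lra.
have w0 : (0 < w)%R by lra.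
rewrite mul1r lee_fin pwE// powR_inv1 ?(ltW w0)// invf_ge1//; lra.
Qed.

(* Halving eps adds a fixed amount, by invariance of dw/w under dilation. *)
Lemma log_intD eps : (0 < eps <= 1)%R -> log_int 2^-1 + log_int eps <= log_int (2^-1 * eps).
Proof.
move=> /andP[e0 e1].
have -> : log_int eps = \int[mu]_w (((eps < 2 * w) && (2 * w < 1))%R%:R * pw (-1) w)%:E.
  pose g (z : R) : \bar R := (((eps < z) && (z < 1))%R%:R)%:E.
  have mg : measurable_fun setT g by rewrite /g; meas.
  have g0 z : 0 <= g z by rewrite lee_fin.
  transitivity (\int[mu]_w (g w * (pw (-1) w)%:E)).
    by apply: eq_integral => w _; rewrite -EFinM.
  rewrite -(@ge0_integral_haar _ g 2)//.
rewrite /log_int -ge0_integralD; [|exact: measurableT|by pos|by meas|by pos|by meas].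
apply: le_integral_nonmeas => w; first by pos.
rewrite -EFinD lee_fin -mulrDl; apply: ler_wpM2r; first exact: pw_ge0.
rewrite -natrD ler_nat.
case: (boolP ((2^-1 < w) && (w < 1))%R) => [/andP[w1 w2]|_].
  have -> : (eps < 2 * w)%R by lra.
  have -> : (2 * w < 1)%R = false by apply/negbTE; rewrite -leNgt; lra.
  have -> : (2^-1 * eps < w)%R by lra.
  by rewrite w2.
case: (boolP ((eps < 2 * w) && (2 * w < 1))%R) => [/andP[w1 w2]|_] //.
have -> : (2^-1 * eps < w)%R by lra.
by have -> : (w < 1)%R by lra.
Qed.

Lemma log_int_ge m : (m%:R / 8 : R)%:E <= log_int ((2^-1) ^+ m).
Proof.
elim: m => [|m IH]; first by rewrite mul0r log_int_ge0.
have p0 : (0 < (2^-1) ^+ m :> R)%R by rewrite exprn_gt0// invr_gt0.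
have p1 : ((2^-1) ^+ m <= 1 :> R)%R by rewrite exprn_ile1// ?invr_ge0// invf_le1// ler1n.
rewrite exprS; apply: (le_trans _ (log_intD _)); last by rewrite p0.
rewrite -natr1 mulrDl mul1r addrC EFinD; apply: leeD => //.
exact: log_int_half.
Qed.

Definition log_test (eps w : R) : R :=
  (((eps < w) && (w < 1))%R%:R * pw (- (n.+1%:R / 2)) w)%R.

(** For t = r the sphere passes through the origin and w = 2 r^2 (1 - v). The weight (1 -
    v)^((d-3)/2) then turns w^(-(d-1)/2) into 1/w, up to powers of c = 1/(2 r^2) in [1/8, 1/2] and
    of 2 - w c in [1, 2], which are bounded below. *)
Lemma sphA_log_test : exists2 k : R, (0 < k)%R & forall eps r : R,
  (0 < eps)%R -> (0 <= r)%R -> (1 < r ^+ 2 < 4)%R ->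
  k%:E * log_int eps <= sphA n (log_test eps) r r.
Proof.
pose m1 := Num.min (pw gam 8^-1) (pw gam 2^-1).
pose m2 := Num.min (pw gam 1) (pw gam 2).
have m10 : (0 < m1)%R by rewrite lt_min !pw_gt0// invr_gt0.
have m20 : (0 < m2)%R by rewrite lt_min !pw_gt0.
exists (8^-1 * (m1 * m2))%R; first by rewrite !mulr_gt0.
move=> eps r e0 r0 /andP[r1 r4].
pose A := (2 * r ^+ 2)%R; pose c := A^-1%R.
have rn0 : (r != 0)%R by apply/eqP => r00; move: r1; rewrite r00 expr0n /= ltr10.
have A0 : (0 < A)%R by rewrite /A; lra.
have c0 : (0 < c)%R by rewrite invr_gt0.
have c8 : (8^-1 <= c)%R by rewrite /c lef_pV2 ?posrE// /A; lra.
have c2 : (c <= 2^-1)%R by rewrite /c lef_pV2 ?posrE// /A; lra.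
pose F (w : R) := (log_test eps w * (pw gam (w * c) * pw gam (2 - w * c)))%:E.
have mF : measurable_fun setT F by rewrite /F /log_test; meas.
have F0 w : 0 <= F w by rewrite /F /log_test; pos.
have -> : sphA n (log_test eps) r r = c%:E * \int[mu]_w F w.
  rewrite -(ge0_integral_opp mF F0).
  etransitivity; last first.
    by apply: (ge0_integral_affine (- A) A0); [by apply: (measurableT_comp mF); meas|by move=> w; apply: F0].
  apply: eq_integral => v _; rewrite /F; congr (_%:E).
  have -> : (- (A * v - A) = r ^+ 2 + r ^+ 2 - 2 * r * r * v)%R by rewrite /A; ring.
  rewrite pw_1Bsqr; congr (_ * (pw _ _ * pw _ _))%R.
    by rewrite /c /A; field; rewrite rn0.
  by rewrite /c /A; field; rewrite rn0.
rewrite EFinM -muleA; apply: lee_pmul; [by rewrite lee_fin|by apply: mule_ge0; [rewrite lee_fin mulr_ge0// ltW|exact: log_int_ge0]|by rewrite lee_fin|].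
rewrite /log_int -ge0_integralZl; [|exact: measurableT|by meas|by pos|by rewrite lee_fin mulr_ge0// ltW].
apply: le_integral_nonmeas => w; first by rewrite -EFinM lee_fin mulr_ge0// ?mulr_ge0// ?pw_ge0// ltW.
rewrite /F /log_test -EFinM lee_fin.
case: (boolP (_ && _)) => [/andP[w1 w2]|_]; last by rewrite !mul0r mulr0.
rewrite !mul1r.
have w0 : (0 < w)%R by exact: lt_trans w1.
rewrite mulrC pwM//.
rewrite [leRHS](_ : _ = pw (-1) w * (pw gam c * pw gam (2 - w * c)))%R; last first.
  have := pwD (- (n.+1%:R / 2))%R gam w.
  by rewrite addrA addNr add0r => ->; ring.
apply: ler_wpM2l; first exact: pw_ge0.
have wc1 : (w * c < 2^-1)%R by nra.
have wc0 : (0 < w * c)%R by rewrite mulr_gt0.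
apply: ler_pM; [exact: ltW|exact: ltW| |].
  by apply: pw_ge_min; [rewrite invr_gt0|rewrite c8].
by apply: pw_ge_min; [|apply/andP; split; lra].
Qed.

End LogarithmicTest.

(** * Exclusion of p <= d/(d-1) *)

Section NecessityEndpoint.
Variables (R : realType) (n : nat).
Local Notation d := n.+2.
Implicit Types (psi h : R -> R).
Local Open Scope ereal_scope.
Local Notation E12 := (`[1%R, 2%R]%classic : set R).
Local Notation e := (d%:R / 2 - 1 : R)%R.

Lemma log_test_ge0 eps w : (0 <= log_test n eps w :> R)%R.
Proof. by rewrite mulr_ge0// pw_ge0. Qed.

Lemma log_test_powR (a eps w : R) : (0 < a)%R -> (0 < eps)%R ->
  ((log_test n eps w) `^ a^-1 * pw e w =
   ((eps < w) && (w < 1))%R%:R * pw (e - n.+1%:R / 2 / a) w)%R.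
Proof.
move=> a0 e0; rewrite /log_test; case: (boolP (_ && _)) => _.
  by rewrite !mul1r pw_powR ?invr_eq0 ?gt_eqF// -pwD mulNr addrC.
by rewrite !mul0r powR0 ?mul0r// invr_eq0 gt_eqF.
Qed.

Lemma Lnorm_rec_log_test : exists2 k : R, (0 < k)%R & forall (a eps : R),
  (0 < a)%R -> (0 < eps)%R ->
  Lnorm_rec a (fun x : 'rV[R]_d => (log_test n eps (enorm x ^+ 2))%:E) =
  (k%:E * \int[mu]_w (((eps < w) && (w < 1))%R%:R * pw (e - n.+1%:R / 2 / a) w)%:E) `^ a.
Proof.
have [k k0 H] := @integ_radial R n; exists k => // a eps a0 e0.
rewrite /Lnorm_rec gt_eqF//; congr (_ `^ _).
pose h (w : R) := ((log_test n eps w) `^ a^-1)%:E.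
have mh : measurable_fun setT h by rewrite /h /log_test; meas.
have h0 w : 0 <= h w by rewrite lee_fin powR_ge0.
transitivity (integ (fun x : 'rV[R]_d => h (enorm x ^+ 2)%R)).
  congr integ; apply/funext => x; rewrite /h -poweR_EFin; congr (_ `^ _).
  by rewrite /= ger0_norm// log_test_ge0.
rewrite H//; congr (_ * _); apply: eq_integral => w _.
by rewrite /h -EFinM log_test_powR.
Qed.

Lemma necessary_p_gt (a b : R) : (0 <= a <= 1)%R -> (0 <= b)%R -> bounded_rad d E12 a b ->
  (a * d%:R < n.+1%:R)%R.
Proof.
move=> /andP[a0 a1] b0 /(bounded_rad_test b0) [C C0 HC].
rewrite ltNge; apply/negP => ad.
have {}a0 : (0 < a)%R.
  by rewrite lt_neqAle a0 andbT; apply/eqP => az; move: ad; rewrite -az mul0r lern0.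
have [k k0 Hk] := @sphA_log_test R n.
have [K K0 HK] := Lnorm_rec_log_test.
have [V V0 HV] := vol_ann_shell R n.
have V1 : (0 < V `^ b)%R by rewrite powR_gt0.
(* The power m.+1 keeps eps strictly below 1, so that every l m is positive and finite. *)
pose l m : R := fine (log_int ((2^-1) ^+ m.+1 : R)).
have p0 m : (0 < (2^-1) ^+ m.+1 :> R)%R by rewrite exprn_gt0// invr_gt0.
have p1 m : ((2^-1) ^+ m.+1 < 1 :> R)%R by rewrite exprn_ilt1// ?invr_ge0// invf_lt1// ltr1n.
have lE m : log_int ((2^-1) ^+ m.+1 : R) = (l m)%:E.
  by rewrite fineK// ge0_fin_numE ?log_int_ge0// log_int_lty// p0 p1.
have lge m : (m.+1%:R / 8 <= l m)%R by rewrite -lee_fin -lE log_int_ge.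
have l0 m : (0 < l m)%R by apply: lt_le_trans (lge m); rewrite divr_gt0.
have test m N : (Lnorm_rec a (fun x : 'rV[R]_d => (log_test n ((2^-1) ^+ m.+1) (enorm x ^+ 2))%:E) <= N%:E) ->
    (k * l m * V `^ b <= C * N)%R.
  move=> LN; have mt : measurable_fun setT (log_test n ((2^-1) ^+ m.+1) : R -> R) by rewrite /log_test; meas.
  have := HC _ 1%R 4%R (k * l m)%R N mt (log_test_ge0 _).
  rewrite HV poweR_EFin -EFinM lee_fin lte_fin; apply => //.
    by rewrite mulr_ge0// ltW.
  move=> r r0 r14; exists r; last by rewrite EFinM -lE Hk.
  by apply/andP; split; nra.
have unbounded (B : R) : ~ (forall m, (l m <= B)%R).
  move=> lB; have := lB (Num.truncn (8 * `|B|))%R; apply/negP; rewrite -ltNge.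
  apply: lt_le_trans (lge _); rewrite ltr_pdivlMr// mulrC.
  apply: le_lt_trans (truncnS_gt _); apply: ler_wpM2l => //; exact: ler_norm.
(* The norm is at most (K l)^a, so the test bounds l^(1-a) along an unbounded sequence. *)
have a_ge1 : (1 - a <= 0)%R.
  apply: (@powR_growth _ _ (C * K `^ a / (k * V `^ b))%R) => L0.
  have [m lm] : exists m, (L0 <= l m)%R.
    apply: contrapT => /forallNP H; apply: (unbounded L0) => m.
    by apply: ltW; rewrite ltNge; apply/negP; exact: H.
  exists (l m); first exact: lm.
  have Kl : Lnorm_rec a (fun x : 'rV[R]_d => (log_test n ((2^-1) ^+ m.+1) (enorm x ^+ 2))%:E) <= ((K * l m) `^ a)%:E.
    rewrite HK// -poweR_EFin; apply: ge0_le_poweR; first exact: ltW.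
      by apply: mule_ge0; [rewrite lee_fin ltW|pos].
    rewrite EFinM -lE; apply: lee_wpmul2l; first by rewrite lee_fin ltW.
    apply: le_integral_nonmeas => w; first by pos.
    rewrite lee_fin; case: (boolP (_ && _)) => [/andP[w1 w2]|_]; last by rewrite !mul0r.
    have w0 : (0 < w)%R by exact: lt_trans w1.
    rewrite !mul1r !pwE//; apply: ger_powR; first by rewrite w0 ltW.
    suff : (n.+1%:R / 2 / a <= d%:R / 2)%R by lra.
    by rewrite ler_pdivrMr// mulrAC ler_pM2r// mulrC.
  have := test m _ Kl.
  rewrite powRB; last by rewrite (gt_eqF (l0 m)) implybT.
  rewrite powRr1 ?(ltW (l0 m))// powRM ?(ltW K0) ?(ltW (l0 m))// => H.
  have la : (0 < l m `^ a)%R by rewrite powR_gt0.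
  by rewrite ler_pdivrMr// mulrAC ler_pdivlMr ?mulr_gt0//; lra.
have ae : a = 1%R by lra.
(* For a = 1 the exponent is -1/2, integrable at 0. The norms stay bounded uniformly in eps while l
   m grows. *)
have pf := pint_fin (_ : 0 < 2^-1 :> R)%R.
apply: (unbounded (C * (K * fine (pint (2^-1 : R))) / (k * V `^ b))%R) => m.
rewrite ler_pdivlMr ?mulr_gt0//.
suff /test : Lnorm_rec a (fun x : 'rV[R]_d => (log_test n ((2^-1) ^+ m.+1) (enorm x ^+ 2))%:E) <= (K * fine (pint (2^-1 : R)))%:E by lra.
rewrite HK// ae poweRe1; last by apply: mule_ge0; [rewrite lee_fin ltW|pos].
rewrite EFinM fineK ?pf ?invr_gt0//; apply: lee_wpmul2l; first by rewrite lee_fin ltW.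
apply: le_integral_nonmeas => w; first by pos.
rewrite -EFinM lee_fin (_ : e - n.+1%:R / 2 / 1 = 2^-1 - 1)%R; last by rewrite -(natr1 n.+1); field.
apply: ler_wpM2r; first exact: pw_ge0.
by rewrite ler_nat; case: (_ < w)%R.
Qed.
End NecessityEndpoint.

(** For beta = 1 the denominator d^2 - 1 + beta is d^2, so Q1 = (x, x) and Q2 = (x, x/d) with x =
    (d-1)/d. The side from Q1 to Q2 is vertical, and removing it makes a <= x strict; the other two
    sides lie on b = a and a = d b. *)
Lemma Delta_diff_segment (R : realType) (n : nat) :
  Delta n.+2 (1 : R) `\` segment (Q1 n.+2 1) (Q2 n.+2 1) =
  [set ab : R * R | [/\ ab.1 * n.+2%:R < n.+1%:R, ab.1 <= ab.2 * n.+2%:R & ab.2 <= ab.1]].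
Proof.
rewrite /Delta /segment /Q1 /Q2 /=.
set m : R := n.+1%:R.
have DE : n.+2%:R = m + 1 :> R by rewrite natr1.
have m1 : 1 <= m by rewrite ler1n.
have -> : ((n.+2 ^ 2).-1)%:R + 1 = (m + 1) ^+ 2 :> R.
  by rewrite natr1 prednK ?expn_gt0// natrX DE.
rewrite natrM -/m DE; clearbody m.
have m0 : m != 0 by rewrite gt_eqF//; lra.
have D0 : m + 1 != 0 by rewrite gt_eqF//; lra.
set x := m / (m + 1); set y := m / (m + 1) ^+ 2.
have -> : (m + 1) * m / (m + 1) ^+ 2 = x by rewrite /x; field.
have xE : x * (m + 1) = m by rewrite /x divfK.
have yE : y * (m + 1) = x by rewrite /x /y; field.
have y0 : 0 < y by rewrite divr_gt0// ?exprn_gt0//; lra.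
have yx : y < x by nra.
apply/seteqP; split => -[a b] /=.
  move=> [[l1 [l2 [l10 [l20 [l12 [-> ->]]]]]] nseg].
  have l12n : l1 + l2 != 1.
    apply/eqP => l1E; apply: nseg; exists l2; split; first by rewrite l20 -l1E lerDr.
    by have -> : 1 - l2 = l1 by lra.
  have {}l12 : l1 + l2 < 1 by rewrite lt_neqAle l12n.
  have x0 : 0 < x by lra.
  split.
  - by rewrite -mulrDl -mulrA xE; nra.
  - by rewrite mulrDl -(mulrA l1) -(mulrA l2) xE yE; nra.
  - by nra.
move=> [am ab ba]; split.
  (* These solve the linear system for the coordinates along Q1 and Q2; their sum is a/x. *)
  exists ((b * (m + 1) - a) * (m + 1) / m ^+ 2), ((a - b) * (m + 1) ^+ 2 / m ^+ 2).
  have mi : 0 <= (m ^+ 2)^-1 by rewrite invr_ge0 sqr_ge0.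
  split; [|split; [|split]].
  - by apply: mulr_ge0 => //; apply: mulr_ge0; lra.
  - by apply: mulr_ge0 => //; apply: mulr_ge0; [lra|exact: sqr_ge0].
  - rewrite [leLHS](_ : _ = a * (m + 1) / m); last by field.
    by rewrite ler_pdivrMr ?mul1r ?ltW//; lra.
  - by congr pair; rewrite /x /y; field; rewrite m0 D0.
move=> [s [_ [aE _]]]; move: am; rewrite aE -mulrDl subrK mul1r xE.
by rewrite ltxx.
Qed.

Theorem theorem1p1 (R : realType) (d : nat) (hd : (2 <= d)%N) :
  type_set_rad d (`[1, 2] : set R) =
  Delta d 1 `\` segment (Q1 d 1) (Q2 d 1).
Proof.
case: d hd => [|[|n]]// _; rewrite Delta_diff_segment.
apply/seteqP; split => -[a b] /=.
  move=> [/= /andP[a0 a1] [/andP[b0 b1] H]]; split => /=.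
  - by apply: necessary_p_gt b0 H; rewrite a0.
  - exact: necessary_q_le_dp H.
  - exact: necessary_q_ge_p H.
have D2 : 2 <= n.+2%:R :> R by rewrite ler_nat.
have DE : n.+2%:R = n.+1%:R + 1 :> R by rewrite natr1.
move=> [/= am ab ba].
have a0 : 0 <= a by nra.
have b0 : 0 <= b by nra.
have a1 : a <= 1 by nra.
split; first by rewrite a0.
split; first by rewrite b0 (le_trans ba).
(* a = 0 forces b = 0, the vertex O, where the norms are essential suprema. *)
move: a0; rewrite le_eqVlt => /predU1P[az|a0]; last exact: bounded_rad_pos.
have -> : b = 0 by apply: le_anti; rewrite b0 andbT az.
rewrite -az; exact: bounded_rad_infty.
Qed.
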